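(* Let $C:f=0$ be a reduced plane curve of degree $d$ in $\mathbb{P}^2$ over $\mathbb{C}$, set $r=\mathrm{mdr}(f)$ with $r\ge 1$, let $\rho_1\in AR(f)_r$ be a nonzero syzygy and consider the associated subscheme $Z(C,\rho_1)$ of $\mathbb{P}^2$. If $2r\le d$, then any line $L$ in $\mathbb{P}^2$ which avoids the support of $Z(C,\rho_1)$ is not a jumping line. More precisely, the (unordered) splitting type of $E_C$ along $L$ is $(r,d-1-r)$.
   Context: $S=\mathbb{C}[x,y,z]$ with the usual grading; for a graded module $M$, $M(m)_k=M_{m+k}$; $f\in S_d$ is the reduced homogeneous equation of $C$; $f_x,f_y,f_z$ are its partial derivatives. $AR(f)\subset S^3$ is the graded $S$-module with $AR(f)_k=\{(a,b,c)\in S_k^3: af_x+bf_y+cf_z=0\}$ and $\mathrm{mdr}(f)=\min\{k: AR(f)_k\neq 0\}$. $E_C=\widetilde{AR(f)}$ is the associated rank two vector bundle on $\mathbb{P}^2$. For a line $L$, if $E_C|_L\simeq\mathcal{O}_L(-d_1^L)\oplus\mathcal{O}_L(-d_2^L)$, the pair $(d_1^L,d_2^L)$ is the splitting type of $E_C$ along $L$: ordered if one requires $d_1^L\le d_2^L$, unordered otherwise. With the ordered type, $(d_1^{L_0},d_2^{L_0})$ is constant for a generic line $L_0$, and $L$ is a jumping line if $d_1^{L_0}-d_1^L>0$. Given a nonzero $\rho_1=(a_1,b_1,c_1)\in AR(f)_r$, for $\rho=(a,b,c)\in AR(f)_m$ let $\Delta(\rho)$ be the determinant of the $3\times3$ matrix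 with rows $(x,y,z)$, $(a_1,b_1,c_1)$, $(a,b,c)$; it is divisible by $f$, and $v:AR(f)\to S(r-d+1)$ is the graded morphism $v(\rho)=\Delta(\rho)/f$. The homogeneous ideal $B(C,\rho_1)\subset S$ is defined by $\mathrm{im}\,v=B(C,\rho_1)(r-d+1)$, and $Z(C,\rho_1)=V(B(C,\rho_1))\subset\mathbb{P}^2$ is the subscheme it defines (of dimension at most $0$). *)

(* Defs.v *)
From HB Require Import structures.
From mathcomp Require Import all_boot all_order all_algebra.
From mathcomp Require Import complex mpoly reals.

Set Implicit Arguments.
Unset Strict Implicit.
Unset Printing Implicit Defensive.

Import Order.TTheory GRing.Theory Num.Theory.
Local Open Scope ring_scope.

Section Curves.
Variable K : fieldType.
Local Notation S := {mpoly K[3]}.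

(** S_k for k : int; it is 0 for k < 0. *)
Definition homogz (k : int) (p : S) : Prop :=
  match k with
  | Posz n => p \is n.-homog
  | Negz _ => p = 0
  end.

Definition reduced_curve (d : nat) (f : S) : Prop :=
  [/\ (0 < d)%N, f \is d.-homog, f != 0
    & forall g h : S, f = g ^+ 2 * h -> exists c : K, g = c%:MP].

Definition syzygy (f : S) (rho : 'rV[S]_3) : Prop :=
  \sum_(i < 3) rho 0 i * f^`M(i) = 0.

(** The graded piece AR(f)_k. *)
Definition AR (f : S) (k : int) (rho : 'rV[S]_3) : Prop :=
  (forall i, homogz k (rho 0 i)) /\ syzygy f rho.

Definition is_mdr (f : S) (r : nat) : Prop :=
  (exists2 rho, AR f r%:Z rho & rho <> 0) /\
  (forall k : nat, (k < r)%N -> forall rho, AR f k%:Z rho -> rho = 0).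

(** Rows: (x, y, z), rho1, rho. *)
Definition Delta (rho1 rho : 'rV[S]_3) : S :=
  \det (\matrix_(i < 3, j < 3)
          if i == 0 then 'X_j else if i == 1 then rho1 0 j else rho 0 j).

(** The ideal B(C, rho1): the polynomials v(rho) = Delta(rho) / f.  Since
    AR(f) is the sum of its graded pieces and v is graded, letting rho range
    over all (not necessarily homogeneous) syzygies gives all the elements of
    this homogeneous ideal. *)
Definition idealB (f : S) (rho1 : 'rV[S]_3) (b : S) : Prop :=
  exists2 rho, syzygy f rho & Delta rho1 rho = b * f.

(** Points of P^2 are represented by nonzero vectors. *)
Definition suppZ (f : S) (rho1 : 'rV[S]_3) (p : 'rV[K]_3) : Prop :=
  p != 0 /\ forall b, idealB f rho1 b -> b.@[fun i => p 0 i] = 0.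

(** For a != 0, the line L of P^2 with equation a_0 x + a_1 y + a_2 z = 0;
    a is a point of the dual plane. *)
Definition line_eq (a : 'rV[K]_3) : S := \sum_(i < 3) a 0 i *: 'X_i.

Definition on_line (a p : 'rV[K]_3) : Prop :=
  (line_eq a).@[fun i => p 0 i] = 0.

(** A graded S-module, given by its graded pieces inside an S-module V. *)
Definition gpieces (V : lmodType S) := int -> V -> Prop.

(** The sheaf associated with M, restricted to the line L : l = 0, is the sheaf
    associated with M / l M.  Its sections over the basic open subset D_+(g) of
    L, for g homogeneous of degree e > 0, form the degree-0 localization
    (M / l M)_(g): the fractions m / g^n with m in M_(n e), encoded as (m, n),
    modulo the equality [sec_eq]. *)
Section Sections.
Variables (V : lmodType S) (M : gpieces V) (l : S).
Implicit Types (u v : V * nat) (g h : S) (e : nat).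

Definition is_sec e u : Prop := M (u.2 * e)%N%:Z u.1.

(** m / g^n = m' / g^n' iff g^k (g^n' m - g^n m') lies in l M for some k. *)
Definition sec_eq e g u v : Prop :=
  exists k : nat, exists2 w : V,
    M (((k + u.2 + v.2) * e)%N%:Z - 1) w &
    g ^+ k *: (g ^+ v.2 *: u.1 - g ^+ u.2 *: v.1) = l *: w.

Definition sec_add g u v : V * nat :=
  (g ^+ v.2 *: u.1 + g ^+ u.2 *: v.1, (u.2 + v.2)%N).

(** Multiplication by the regular function s.1 / g^(s.2). *)
Definition sec_scale (s : S * nat) u : V * nat :=
  (s.1 *: u.1, (s.2 + u.2)%N).

(** Restriction from D_+(g) to D_+(g h). *)
Definition sec_res h u : V * nat := (h ^+ u.2 *: u.1, u.2).

End Sections.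

(** Isomorphism of sheaves of O_L-modules: O_L(D_+(g))-linear bijections between
    the sections over all basic open sets D_+(g), compatible with
    restrictions. *)
Record sheaf_iso_on_line (V W : lmodType S) (M : gpieces V) (N : gpieces W)
    (l : S) (phi : S -> V * nat -> W * nat) : Prop := SheafIsoOnLine {
  siso_sec : forall e g u, (0 < e)%N -> g \is e.-homog ->
    is_sec M e u -> is_sec N e (phi g u);
  siso_inj : forall e g u v, (0 < e)%N -> g \is e.-homog ->
    is_sec M e u -> is_sec M e v ->
    (sec_eq M l e g u v <-> sec_eq N l e g (phi g u) (phi g v));
  siso_surj : forall e g w, (0 < e)%N -> g \is e.-homog ->
    is_sec N e w -> exists2 u, is_sec M e u & sec_eq N l e g (phi g u) w;
  siso_add : forall e g u v, (0 < e)%N -> g \is e.-homog ->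
    is_sec M e u -> is_sec M e v ->
    sec_eq N l e g (phi g (sec_add g u v)) (sec_add g (phi g u) (phi g v));
  siso_scale : forall e g (s : S * nat) u, (0 < e)%N -> g \is e.-homog ->
    s.1 \is (s.2 * e)%N.-homog -> is_sec M e u ->
    sec_eq N l e g (phi g (sec_scale s u)) (sec_scale s (phi g u));
  siso_res : forall e g e' h u, (0 < e)%N -> g \is e.-homog ->
    h \is e'.-homog -> is_sec M e u ->
    sec_eq N l (e + e')%N (g * h)
      (phi (g * h) (sec_res h u)) (sec_res h (phi g u))
}.

Definition isomorphic_on_line (V W : lmodType S) (M : gpieces V)
    (N : gpieces W) (l : S) : Prop :=
  exists phi, sheaf_iso_on_line M N l phi.

(** S(-d1) (+) S(-d2), whose associated sheaf is O(-d1) (+) O(-d2). *)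
Definition twist2 (d1 d2 : int) : gpieces 'rV[S]_2 := fun k m =>
  homogz (k - d1) (m 0 0) /\ homogz (k - d2) (m 0 1).

(** (d1, d2) is the unordered splitting type of E_C along the line a:
    E_C|_L is isomorphic to O_L(-d1) (+) O_L(-d2). *)
Definition splitting_type (f : S) (a : 'rV[K]_3) (d1 d2 : int) : Prop :=
  isomorphic_on_line (AR f) (twist2 d1 d2) (line_eq a).

Definition ordered_splitting_type (f : S) (a : 'rV[K]_3) (d1 d2 : int) : Prop :=
  d1 <= d2 /\ splitting_type f a d1 d2.

(** Generic means: on a nonempty Zariski open subset of the dual plane, which
    may be taken to be the complement of a curve P = 0. *)
Definition generic_splitting_type (f : S) (d1 d2 : int) : Prop :=
  exists P : S, [/\ P != 0, exists n : nat, P \is n.-homog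
    & forall a : 'rV[K]_3, a != 0 -> P.@[fun i => a 0 i] != 0 ->
        ordered_splitting_type f a d1 d2].

Definition jumping_line (f : S) (a : 'rV[K]_3) : Prop :=
  exists e1 e2 d1 d2 : int,
    [/\ generic_splitting_type f e1 e2, ordered_splitting_type f a d1 d2
      & 0 < e1 - d1].

End Curves.

(* Main.v *)
(** The kernel of v is S rho1: S is factorial and rho1 has minimal degree, so
    every syzygy proportional to rho1 is a multiple of it. Where Z does not meet
    the line L this gives an exact sequence
      0 -> O_L(-r) -> E_C|_L -> O_L(-(d - 1 - r)) -> 0,
    which splits because H^1(O_L(d - 1 - 2r)) = 0 for 2r <= d. Concretely, let t
    be an affine coordinate on L. Up to twist, v maps some m0 and m1 in AR(f) to
    1 and t^N on L; then t^N m0 - m1 is c rho1 on L for some c, and separating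
    the powers of t below and above t^N in c corrects m0 and m1 into restrictions
    of one section over L, which together with rho1 splits E_C|_L.

    For the jumping statement, let (e1, e2) be the generic type, attained on some
    line L0. The syzygy rho1 does not vanish identically on L0, so e1 <= r. For k
    large, dim AR(f)_k - dim AR(f)_(k-1) is at least 2(k+1) - (d-1), as seen on L,
    and at most 2(k+1) - e1 - e2, as seen on L0; hence e1 + e2 <= d - 1. With
    2r <= d this gives e1 <= min(r, d-1-r), the smaller degree on L. *)

Require Import Defs.
From HB Require Import structures.
From mathcomp Require Import all_boot all_order all_algebra.
From mathcomp Require Import complex mpoly reals boolp ring zify.

Set Implicit Arguments.
Unset Strict Implicit.
Unset Printing Implicit Defensive.

Import Order.TTheory GRing.Theory Num.Theory.
Local Open Scope ring_scope.

(** * Factorial rings *)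

(** An isomorphism of sheaves has to be given on every [D_+(g)]. What makes this manageable is that
    [AR(f)] meets [l S^3] in [l AR(f)]: then [AR(f) / l AR(f)] embeds into triples over [K[t]], and
    equalities of sections become polynomial identities. A splitting is a pair [sigma1], [sigma2]
    over [K[t]] in which elements of [AR(f)_k] have coordinates of degree at most [k - r] and
    [k - s], where [s = d - 1 - r]; the converse lifting is needed only for large [k], because
    fractions can be expanded by powers of [g]. In the other direction, a given isomorphism need not
    come from a map of modules, and only its effect on global sections of twists, glued from two
    charts, is extracted. Factoriality of [S] serves twice: for the kernel of [v], and for the
    divisibility of [Delta] by [f]. The affine chart misses one point of the line, which is why [1]
    and [t^N] are obtained by different arguments. *)

Section Factorization.
Variable R : idomainType.
Implicit Types (a b c p q u x : R) (s : seq R).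

Definition dvdr a b := exists c, b = c * a.

Definition prime_elt p :=
  [/\ p != 0, p \isn't a GRing.unit
    & forall a b, dvdr p (a * b) -> dvdr p a \/ dvdr p b].

Definition factorization x u s :=
  [/\ u \is a GRing.unit, {in s, forall p, prime_elt p} & x = u * \prod_(p <- s) p].

Lemma dvdr_mull a b c : dvdr a b -> dvdr a (c * b).
Proof. by case=> d ->; exists (c * d); rewrite mulrA. Qed.

Lemma dvdr_mulr a b c : dvdr a b -> dvdr a (b * c).
Proof. by rewrite mulrC; exact: dvdr_mull. Qed.

Lemma dvdrB a b c : dvdr a b -> dvdr a c -> dvdr a (b - c).
Proof. by move=> [d ->] [e ->]; exists (d - e); rewrite mulrBl. Qed.

Lemma dvdrr a : dvdr a a.
Proof. by exists 1; rewrite mul1r. Qed.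

Lemma prime_dvdr_unit p u : prime_elt p -> u \is a GRing.unit -> ~ dvdr p u.
Proof.
move=> [_ pNu _] uu [c cE]; move: uu; rewrite cE unitrM => /andP[_ pu].
by rewrite pu in pNu.
Qed.

Lemma prime_dvdr_prod p s : prime_elt p -> dvdr p (\prod_(q <- s) q) ->
  exists2 q, q \in s & dvdr p q.
Proof.
move=> pp; elim: s => [|q s IHs].
  by rewrite big_nil => /(prime_dvdr_unit pp); rewrite unitr1 => /(_ isT).
rewrite big_cons => /(let: And3 _ _ h := pp in h _ _) [pq|/IHs[x xs px]].
  by exists q; rewrite ?mem_head.
by exists x; rewrite // inE xs orbT.
Qed.

Lemma prime_dvdr_prime p q : prime_elt p -> prime_elt q -> dvdr p q ->
  exists2 u, u \is a GRing.unit & q = u * p.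
Proof.
move=> pp [q0 qNu hq] [c cE]; exists c => //.
have [p0 pNu _] := pp.
case: (hq c p); first by rewrite -cE; exact: dvdrr.
  case=> d dE; case/negP: pNu; apply/unitrPr; exists d.
  have c0 : c != 0 by apply: contraNneq q0 => c0; rewrite cE c0 mul0r.
  by apply: (mulfI c0); rewrite mulr1 mulrA -cE mulrC -dE.
case=> d dE; apply/unitrPr; exists d.
by apply: (mulIf p0); rewrite mul1r -mulrA mulrCA -cE -dE.
Qed.

Lemma unit_or_prime_divisor x u s : factorization x u s ->
  x \is a GRing.unit \/ exists2 p, prime_elt p & dvdr p x.
Proof.
case: s => [|p s] [uu sp ->]; first by left; rewrite big_nil mulr1.
right; exists p; first exact: (sp p (mem_head _ _)).
by rewrite big_cons; apply/dvdr_mull/dvdr_mulr/dvdrr.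
Qed.

Lemma factorization_mul x1 u1 s1 x2 u2 s2 :
  factorization x1 u1 s1 -> factorization x2 u2 s2 ->
  factorization (x1 * x2) (u1 * u2) (s1 ++ s2).
Proof.
move=> [uu1 p1 ->] [uu2 p2 ->]; split.
- by rewrite unitrM uu1.
- by move=> p; rewrite mem_cat => /orP[/p1|/p2].
- by rewrite big_cat /= mulrACA.
Qed.

End Factorization.

Definition factorial_ring (R : idomainType) :=
  forall x : R, x != 0 -> exists u s, factorization x u s.

(** * Polynomials over a factorial ring *)

Section GaussLemma.
Variable R : idomainType.
Hypothesis ufdR : factorial_ring R.
Implicit Types (c p : R) (q h : {poly R}).

(** Content one, phrased through prime divisors so that no gcd of coefficients is required. *)
Definition primitive q := forall p, prime_elt p -> ~ dvdr p%:P q.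

Lemma dvdrC_lead p q : dvdr p%:P q -> dvdr p (lead_coef q).
Proof.
by move=> [h ->]; rewrite lead_coefM lead_coefC; apply/dvdr_mull/dvdrr.
Qed.

(** Gauss's lemma. If [p] divides [a * b], it divides the product of the leading coefficients, hence
    one of them; deleting that leading term keeps the divisibility and shortens a factor, which
    drives the induction. *)
Lemma prime_polyC p : prime_elt p -> prime_elt p%:P.
Proof.
move=> [p0 pNu hp]; split; rewrite ?polyC_eq0 //.
  by rewrite poly_unitE negb_and coefC eqxx pNu orbT.
move=> a b; have [n] := ubnP (size a + size b).
elim: n => // n IHn in a b *; rewrite ltnS => ab dab.
have [->|a0] := eqVneq a 0; first by left; exists 0; rewrite mul0r.
have [->|b0] := eqVneq b 0; first by right; exists 0; rewrite mul0r.
have truncate q : q != 0 -> dvdr p (lead_coef q) ->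
    exists q', (size q' < size q)%N /\ dvdr p%:P (q - q').
  move=> q0 [c cE]; exists (q - lead_coef q *: 'X^((size q).-1)); split.
    have sq : (0 < size q)%N by rewrite lt0n size_poly_eq0.
    rewrite -(prednK sq) ltnS; apply/leq_sizeP => j.
    rewrite coefB coefZ coefXn leq_eqVlt => /predU1P[<-|].
      by rewrite eqxx mulr1 subrr.
    move=> jq; rewrite nth_default; last by rewrite -(prednK sq).
    by rewrite gtn_eqF ?mulr0 ?subr0.
  rewrite opprB addrC subrK cE; exists (c *: 'X^((size q).-1)).
  by rewrite -!mul_polyC polyCM mulrAC.
have : dvdr p (lead_coef a * lead_coef b) by rewrite -lead_coefM; exact: dvdrC_lead.
case/hp => [/(truncate a a0)[a' [sa' [h hE]]]|/(truncate b b0)[b' [sb' [h hE]]]].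
- have aE : a = a' + h * p%:P by rewrite -hE addrC subrK.
  case: (IHn a' b); first by lia.
    have -> : a' * b = a * b - h * p%:P * b by rewrite aE mulrDl addrK.
    by apply: dvdrB => //; apply/dvdr_mulr/dvdr_mull/dvdrr.
    by case=> c cE; left; exists (c + h); rewrite mulrDl -cE.
  by right.
- have bE : b = b' + h * p%:P by rewrite -hE addrC subrK.
  case: (IHn a b'); first by lia.
    have -> : a * b' = a * b - a * (h * p%:P) by rewrite bE mulrDr addrK.
    by apply: dvdrB => //; apply/dvdr_mull/dvdr_mull/dvdrr.
    by left.
  by case=> c cE; right; exists (c + h); rewrite mulrDl -cE.
Qed.

Lemma primitive_dvdr q h : primitive q -> dvdr h q -> primitive h.
Proof.
move=> qp [c cE] p pp ph; apply: (qp p pp).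
by rewrite cE; exact: dvdr_mull.
Qed.

(** The primes of [c] are removed one at a time: each divides [h * q] but not the primitive [q], so
    it divides [h]. *)
Lemma primitive_cancel c q a h : c != 0 -> primitive q ->
  c%:P * a = h * q -> dvdr q a.
Proof.
move=> c0 qp; have [u [s [uu sp cE]]] := ufdR c0.
rewrite {c c0}cE; elim: s => [|p s IHs] in sp h *.
  rewrite big_nil mulr1 => aE; exists (u^-1%:P * h).
  by rewrite -mulrA -aE mulrA -polyCM mulVr // mul1r.
rewrite big_cons mulrCA rmorphM -mulrA => aE.
have pp : prime_elt p by apply: sp; rewrite mem_head.
have /(let: And3 _ _ hp := prime_polyC pp in hp _ _) : dvdr p%:P (h * q).
  by rewrite -aE; apply/dvdr_mulr/dvdrr.
case=> [[h' hE]|/(qp _ pp)//].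
apply: (IHs _ h'); first by move=> x xs; apply: sp; rewrite inE xs orbT.
have p0 : p%:P != 0 by rewrite polyC_eq0; case: pp.
by apply: (mulfI p0); rewrite aE hE mulrA [p%:P * h']mulrC.
Qed.

(** [irreducible_poly] and [%|] see divisibility only up to a nonzero constant, as over the fraction
    field; [primitive_cancel] brings it back to divisibility over [R]. *)
Lemma primitive_irreducible_prime q :
  primitive q -> irreducible_poly q -> prime_elt q.
Proof.
move=> qp [sq qirr]; have q0 : q != 0 by rewrite -size_poly_gt0 ltnW.
split=> //; first by rewrite poly_unitE negb_and neq_ltn sq orbT.
move=> a b [c abE].
have dvdpE h : q %| h -> dvdr q h.
  case/Pdiv.Idomain.dvdpP=> -[k g] /= k0; rewrite -mul_polyC => /(primitive_cancel k0); exact.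
have [qa|qNa] := boolP (q %| a); [by left; exact: dvdpE|right; apply: dvdpE].
have /Gauss_dvdpr <- : coprimep q a.
  rewrite coprimep_def; apply/negPn/negP => /qirr/(_ (dvdp_gcdl _ _)).
  by move=> /eqp_dvdl e; move: qNa; rewrite -e dvdp_gcdr.
by rewrite abE dvdp_mulIr.
Qed.

(** Induction on the number of prime factors of the leading coefficient: a prime constant dividing
    [q] divides that coefficient, and dividing it out removes one factor. *)
Lemma primitive_part q : q != 0 ->
  exists c q', [/\ c != 0, primitive q' & q = c%:P * q'].
Proof.
move=> q0; have l0 : lead_coef q != 0 by rewrite lead_coef_eq0.
have [u [s]] := ufdR l0; have [n] := ubnP (size s); move: q0 {l0}.
elim: n => // n IHn in q u s *; rewrite ltnS => q0 sn [uu sp lE].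
have [[p pp [h hE]]|qp] := EM (exists2 p, prime_elt p & dvdr p%:P q); last first.
  exists 1, q; rewrite oner_neq0 mul1r; split=> // p pp pq.
  by apply: qp; exists p.
have h0 : h != 0 by apply: contraNneq q0 => h0; rewrite hE h0 mul0r.
have p0 : p != 0 by case: pp.
have : dvdr p (\prod_(x <- s) x).
  have : dvdr p (u * \prod_(x <- s) x) by rewrite -lE; apply: dvdrC_lead; exists h.
  by case/(let: And3 _ _ hp := pp in hp _ _) => // /(prime_dvdr_unit pp uu).
case/(prime_dvdr_prod pp) => x xs px.
have [v vu xE] := prime_dvdr_prime pp (sp _ xs) px.
have [|//||c [q' [c0 qp' hE']]] := IHn h (u * v) (rem x s).
- by [].
- by rewrite size_rem //; case: (s) xs sn => //= *; lia.
- split; rewrite ?unitrM ?uu //; first by move=> y /mem_rem/sp.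
  apply: (mulIf p0); move: lE.
  rewrite hE lead_coefM lead_coefC => ->.
  by rewrite (big_rem x xs) /= {1}xE; ring.
exists (p * c), q'; split=> //; first by rewrite mulf_neq0.
by rewrite hE hE' rmorphM /=; ring.
Qed.

Lemma primitive_factorization q : q != 0 -> primitive q ->
  exists u s, factorization q u s.
Proof.
have [n] := ubnP (size q); elim: n => // n IHn in q *; rewrite ltnS => qn q0 qp.
have [sq|sq] := leqP (size q) 1.
  have qE := size1_polyC sq; exists q, [::]; split=> //; last by rewrite big_nil mulr1.
  have c0 : q`_0 != 0 by apply: contraNneq q0 => c0; rewrite qE c0.
  have [u [s /unit_or_prime_divisor[cu|[p pp [c cE]]]]] := ufdR c0.
    by rewrite qE poly_unitE size_polyC c0 coefC eqxx.
  by case: (qp _ pp); exists c%:P; rewrite -polyCM -cE.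
have [qirr|qred] := EM (irreducible_poly q).
  exists 1, [:: q]; split; rewrite ?unitr1 ?big_seq1 ?mul1r //.
  by move=> p; rewrite inE => /eqP ->; exact: primitive_irreducible_prime.
have [h [sh hq hNq]] : exists h, [/\ size h != 1, h %| q & ~~ (h %= q)].
  apply/not_existsP => hn; apply: qred; split=> // h sh hq.
  by apply/negPn/negP => hNq; apply: (hn h).
have h0 : h != 0 by apply: contraTneq hq => ->; rewrite dvd0p.
(* Passing to the primitive part of the divisor turns a factorization over the fraction field into
   one over [R]. *)
have [c [h' [c0 hp hE]]] := primitive_part h0.
have h'q : h' %| q.
  by apply: dvdp_trans hq; rewrite hE dvdp_mulIr.
have shh' : size h' = size h by rewrite hE mul_polyC size_scale.
have [[k g]] := Pdiv.Idomain.dvdpP _ _ h'q.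
rewrite /= -mul_polyC => k0 /(primitive_cancel k0 hp)[m mE].
have m0 : m != 0 by apply: contraNneq q0 => m0; rewrite mE m0 mul0r.
have h'0 : h' != 0 by apply: contraNneq q0 => m1; rewrite mE m1 mulr0.
have sqE : size q = (size m + size h').-1 by rewrite mE size_mul.
have shq : (size h < size q)%N.
  rewrite ltn_neqAle dvdp_leq // andbT; apply: contra hNq.
  by rewrite dvdp_size_eqp.
have sh1 : (1 < size h)%N by rewrite ltn_neqAle eq_sym sh size_poly_gt0.
have sm : (1 < size m)%N by move: sqE shq sh1; rewrite shh'; lia.
have [||u1 [s1 F1]] := IHn m _ m0; first by move: sqE qn sh1; rewrite shh'; lia.
  by apply: (primitive_dvdr qp); exists h'; rewrite mulrC.
have [|u2 [s2 F2]] := IHn h' _ h'0 hp; first by rewrite shh'; lia.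
by exists (u1 * u2), (s1 ++ s2); rewrite mE; exact: factorization_mul.
Qed.

Lemma factorial_ring_poly : factorial_ring {poly R}.
Proof.
move=> q q0; have [c [q' [c0 qp qE]]] := primitive_part q0.
have [u1 [s1 [uu1 p1 cE]]] := ufdR c0.
have q'0 : q' != 0 by apply: contraNneq q0 => q'0; rewrite qE q'0 mulr0.
have [u2 [s2 F2]] := primitive_factorization q'0 qp.
exists (u1%:P * u2), (map polyC s1 ++ s2); rewrite qE; apply: factorization_mul => //.
split; first by rewrite poly_unitE size_polyC coefC eqxx uu1 andbT (memPn _ _ uu1) ?unitr0.
  by move=> p /mapP[x /p1 px ->]; exact: prime_polyC.
by rewrite cE rmorphM rmorph_prod big_map.
Qed.

End GaussLemma.

Lemma factorial_ring_field (K : fieldType) : factorial_ring K.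
Proof.
by move=> x x0; exists x, [::]; split=> //; rewrite ?unitfE // big_nil mulr1.
Qed.

Lemma factorial_ring_iso (R R' : idomainType) (phi : {rmorphism R -> R'})
    (psi : {rmorphism R' -> R}) :
  cancel phi psi -> cancel psi phi -> factorial_ring R -> factorial_ring R'.
Proof.
move=> phiK psiK ufdR x x0.
have psix0 : psi x != 0.
  by apply: contraNneq x0 => psix; rewrite -(psiK x) psix rmorph0.
have [u [s [uu sp xE]]] := ufdR _ psix0.
exists (phi u), (map phi s); split; first exact: rmorph_unit.
  move=> _ /mapP[p /sp[p0 pNu hp] ->]; split.
  - by apply: contraNneq p0 => p0; rewrite -(phiK p) p0 rmorph0.
  - by apply: contra pNu => pu; rewrite -(phiK p) rmorph_unit.
  - move=> a b [c abE].
    case: (hp (psi a) (psi b)); first by exists (psi c); rewrite -rmorphM abE rmorphM phiK.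
      by case=> d dE; left; exists (phi d); rewrite -rmorphM -dE psiK.
    by case=> d dE; right; exists (phi d); rewrite -rmorphM -dE psiK.
by rewrite -[LHS]psiK xE rmorphM rmorph_prod big_map.
Qed.

Lemma eq_mpoly_rmorph n (R S : comNzRingType)
    (phi psi : {rmorphism {mpoly R[n]} -> S}) :
  (forall c, phi c%:MP = psi c%:MP) -> (forall i, phi 'X_i = psi 'X_i) ->
  phi =1 psi.
Proof.
move=> eqC eqX p; rewrite (mpolyE p) !rmorph_sum; apply: eq_bigr => m _.
rewrite -mul_mpolyC !rmorphM eqC; congr (_ * _).
rewrite mpolyXE_id !rmorph_prod; apply: eq_bigr => i _.
by rewrite !rmorphXn eqX.
Qed.

Section MpolyPoly.
Variables (n : nat) (K : fieldType).

Definition poly_mpoly : {rmorphism {poly {mpoly K[n]}} -> {mpoly K[n.+1]}} :=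
  (horner_eval ('X_ord_max : {mpoly K[n.+1]}) \o map_poly (@mwiden n K))%FUN.

Lemma poly_mpolyC c : poly_mpoly c%:P = mwiden c.
Proof. by rewrite /= map_polyC /horner_eval hornerC. Qed.

Lemma poly_mpolyX : poly_mpoly 'X = 'X_ord_max.
Proof. by rewrite /= map_polyX /horner_eval hornerX. Qed.

Lemma muniX_max : muni ('X_ord_max : {mpoly K[n.+1]}) = 'X.
Proof.
rewrite /muni mmapX mmap1U; case: splitP => //= j /eqP.
by rewrite (gtn_eqF (ltn_ord j)).
Qed.

Lemma muniX_widen (i : 'I_n) :
  muni ('X_(widen_ord (leqnSn n) i) : {mpoly K[n.+1]}) = ('X_i)%:P.
Proof.
rewrite /muni mmapX mmap1U; case: splitP => [j /= ij|j /= /eqP].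
  by congr ('X__)%:P; apply/val_inj.
by rewrite ord1 addn0 (ltn_eqF (ltn_ord i)).
Qed.

Lemma muniK : cancel (@muni n K) poly_mpoly.
Proof.
apply: (eq_mpoly_rmorph (phi := (poly_mpoly \o (@muni n K))%FUN) (psi := idfun)).
  by move=> c; change (poly_mpoly (muni c%:MP) = c%:MP); rewrite muniC poly_mpolyC mwidenC.
move=> i; change (poly_mpoly (muni 'X_i) = 'X_i); case: (unliftP ord_max i) => [j ->|->].
  have -> : lift ord_max j = widen_ord (leqnSn n) j.
    by apply/val_inj; rewrite /= /bump leqNgt ltn_ord.
  by rewrite muniX_widen poly_mpolyC mwidenX mnmwiden1.
by rewrite muniX_max poly_mpolyX.
Qed.

Lemma muni_mwiden (c : {mpoly K[n]}) : muni (mwiden c) = c%:P.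
Proof.
move: c; apply: (eq_mpoly_rmorph (phi := (@muni n K \o @mwiden n K)%FUN) (psi := polyC)).
  by move=> c; rewrite [LHS]/= mwidenC muniC.
by move=> i; rewrite [LHS]/= mwidenX mnmwiden1 muniX_widen.
Qed.

Lemma poly_mpolyK : cancel poly_mpoly (@muni n K).
Proof.
elim/poly_ind => [|p c IHp]; first by rewrite !rmorph0.
rewrite (rmorphD poly_mpoly) (rmorphM poly_mpoly) muniD muniM IHp.
by rewrite poly_mpolyX muniX_max poly_mpolyC muni_mwiden.
Qed.

End MpolyPoly.

Lemma factorial_ring_mpoly (K : fieldType) n : factorial_ring {mpoly K[n]}.
Proof.
elim: n => [|n IHn].
  have mc_rmorph : monoid_morphism (@mcoeff 0 K 0%MM).
    split; first by rewrite mcoeff1 eqxx.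
    by move=> p q; rewrite (nvar0_mpolyC p) (nvar0_mpolyC q) -mpolyCM !mpolyCK.
  pose m := GRing.isMonoidMorphism.Build _ _ (@mcoeff 0 K 0%MM) mc_rmorph.
  pose psi := HB.pack_for {rmorphism {mpoly K[0]} -> K} (@mcoeff 0 K 0%MM) m.
  apply: (@factorial_ring_iso K _ (@mpolyC 0 K) psi).
  - exact: mpolyCK.
  - by move=> p /=; rewrite -nvar0_mpolyC.
  - exact: factorial_ring_field.
apply: (factorial_ring_iso (@poly_mpolyK n K) (@muniK n K)).
exact: factorial_ring_poly.
Qed.

(** * Factors of homogeneous polynomials *)

(** Once all powers of ['X] are taken out, the product of the cofactors has nonzero constant
    coefficient; this forces [k = i + j], so the product is [c] and the cofactors are constants. *)
Lemma polyXn_factor (A : idomainType) (p q : {poly A}) (c : A) k :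
  c != 0 -> p * q = c *: 'X^k -> exists a i, p = a *: 'X^i.
Proof.
move=> c0 pqE; have pq0 : p * q != 0.
  by rewrite pqE -mul_polyC mulf_neq0 ?polyC_eq0 // monic_neq0 ?monicXn.
have [i [p' p'0 pE]] := multiplicity_XsubC p 0.
have [j [q' q'0 qE]] := multiplicity_XsubC q 0.
have {}p'0 : ~~ root p' 0.
  by apply: (implyP p'0); apply: contraNneq pq0 => ->; rewrite mul0r.
have {}q'0 : ~~ root q' 0.
  by apply: (implyP q'0); apply: contraNneq pq0 => ->; rewrite mulr0.
rewrite subr0 in pE qE.
have pq'E : (p' * q') * 'X^(i + j) = c *: 'X^k by rewrite -pqE pE qE exprD mulrACA.
have pq'0 : (p' * q')`_0 != 0.
  by rewrite -horner_coef0 hornerM mulf_neq0.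
have kE : k = (i + j)%N.
  apply/eqP; move: (congr1 (fun p : {poly A} => p`_(i + j)) pq'E).
  rewrite coefMXn ltnn subnn coefZ coefXn eq_sym => h.
  by apply: contraNT pq'0 => /negPf jk; rewrite h jk mulr0.
have : p' * q' = c%:P.
  apply: (mulIf (monic_neq0 (monicXn _ (i + j)))).
  by rewrite pq'E kE mul_polyC.
move=> /(congr1 (fun p : {poly A} => size p)).
have p'n0 : p' != 0 by apply: contraNneq p'0 => ->; rewrite root0.
have q'n0 : q' != 0 by apply: contraNneq q'0 => ->; rewrite root0.
rewrite size_mul // size_polyC c0 => sz.
have /size1_polyC p'C : (size p' <= 1)%N.
  have := q'n0; rewrite -size_poly_gt0 => q's.
  move: sz; case: (size q') q's => // b _; case: (size p') => // a.
  by rewrite addnS /= => -[/eqP]; rewrite addn_eq0 => /andP[/eqP ->].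
by exists p'`_0, i; rewrite pE {1}p'C mul_polyC.
Qed.

Section HomogeneousFactors.
Variables (n : nat) (K : fieldType).
Implicit Types p q : {mpoly K[n]}.

(** X_i |-> X_i T, so that the coefficient of T^k is the component of degree k. *)
Definition grading_mor : {rmorphism {mpoly K[n]} -> {poly {mpoly K[n]}}} :=
  mmap (polyC \o @mpolyC n K) (fun i => ('X_i)%:P * 'X).

Lemma coef_grading_mor p k : (grading_mor p)`_k = pihomog mdeg k p.
Proof.
rewrite pihomogE /= /mmap coef_sum [RHS]big_mkcond /=; apply: eq_bigr => m _.
have -> : mmap1 (fun i => ('X_i)%:P * 'X) m = ('X_[m])%:P * 'X^(mdeg m) :> {poly {mpoly K[n]}}.
  rewrite /mmap1 mdegE -prodrXr [in RHS]mpolyXE_id rmorph_prod -big_split /=.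
  by apply: eq_bigr => i _; rewrite exprMn rmorphXn.
rewrite mulrA -polyCM mul_mpolyC coefCM coefXn eq_sym.
by case: eqP => _; rewrite ?mulr1 ?mulr0.
Qed.

Lemma grading_mor_dhomog p k : p \is k.-homog -> grading_mor p = p *: 'X^k.
Proof.
move=> hp; apply/polyP => j; rewrite coef_grading_mor coefZ coefXn.
have [->|jk] := eqVneq j k; first by rewrite mulr1 pihomog_dE.
by rewrite mulr0 (pihomog_ne0 _ hp) // eq_sym.
Qed.

(** A homogeneous product is sent to a monomial in [T], whose factors are monomials; for
    [grading_mor p] this means that [p] has a single component. *)
Lemma dhomog_factorl p q k : p * q \is k.-homog -> p * q != 0 ->
  exists i, p \is i.-homog.
Proof.
move=> /grading_mor_dhomog; rewrite rmorphM => hpq /polyXn_factor/(_ hpq)[a [i pE]].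
exists i; rewrite (pihomog_partitionE (leqnn (mmeasure mdeg p))).
apply: rpred_sum => j _; have [<-|ji] := eqVneq (j : nat) i; first exact: pihomogP.
by rewrite -coef_grading_mor pE coefZ coefXn (negPf ji) mulr0 dhomog0.
Qed.

Lemma dhomog_factor p q k : p * q \is k.-homog -> p * q != 0 ->
  exists i j, [/\ k = (i + j)%N, p \is i.-homog & q \is j.-homog].
Proof.
move=> hpq pq0; have [i hp] := dhomog_factorl hpq pq0.
have [j hq] : exists j, q \is j.-homog by apply: (@dhomog_factorl q p k); rewrite mulrC.
by exists i, j; split=> //; apply: dhomog_uniq pq0 hpq (dhomogM hp hq).
Qed.

End HomogeneousFactors.

Section ProportionalVectors.
Variables (R : idomainType) (n : nat).
Hypothesis ufdR : factorial_ring R.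

(** A prime [x] of [q] divides every entry of [p *: u]. If it did not divide [p], it would divide
    all entries of [u], which is excluded; so it cancels on both sides. *)
Lemma proportional_multiple (u m : 'rV[R]_n) p q :
  q != 0 -> q *: m = p *: u ->
  (forall x w, prime_elt x -> u <> x *: w) -> exists h, m = h *: u.
Proof.
move=> q0 + uprim; have [v [s [uv sp qE]]] := ufdR q0.
rewrite {q q0}qE; elim: s => [|x s IHs] in sp p *.
  rewrite big_nil mulr1 => qm; exists (v^-1 * p).
  by rewrite -scalerA -qm scalerA mulVr // scale1r.
rewrite big_cons mulrCA => qm; have px : prime_elt x by apply: sp; rewrite mem_head.
have x0 : x != 0 by case: px.
have xpu i : dvdr x (p * u 0 i).
  exists (v * \prod_(j <- s) j * m 0 i).
  by move/rowP/(_ i): qm; rewrite !mxE => <-; ring.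
have [[p' pE]|xNp] := EM (dvdr x p).
  apply: (IHs _ p'); first by move=> y ys; apply: sp; rewrite inE ys orbT.
  apply/rowP => i; move/rowP/(_ i): qm; rewrite !mxE pE => e.
  by apply: (mulfI x0); rewrite mulrA e mulrCA mulrA.
have xu i : exists c, u 0 i = c * x.
  by case: px => _ _ /(_ _ _ (xpu i))[/xNp|].
case: (uprim x (\row_i projT1 (cid (xu i))) px).
apply/rowP => i; rewrite !mxE mulrC.
exact: (projT2 (cid (xu i))).
Qed.

End ProportionalVectors.

(** * Syzygies and the determinant Delta *)

Lemma sum3E (V : nmodType) (F : 'I_3 -> V) : \sum_(i < 3) F i = F 0 + F 1 + F 2.
Proof.
rewrite !big_ord_recl big_ord0 addr0 addrA.
by congr (_ + F _ + F _); apply/val_inj.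
Qed.

Lemma det2E (R : comPzRingType) (A : 'M[R]_2) :
  \det A = A 0 0 * A 1 1 - A 0 1 * A 1 0.
Proof.
have e0 : lift (0 : 'I_2) 0 = 1 by apply/val_inj.
have e1 : lift (1 : 'I_2) 0 = 0 by apply/val_inj.
rewrite (expand_det_row _ 0) !big_ord_recl big_ord0 /cofactor !det_mx11 !mxE.
rewrite !(e0, e1) /= expr0 expr1.
ring.
Qed.

Lemma det3E (R : comPzRingType) (A : 'M[R]_3) : \det A =
  A 0 0 * (A 1 1 * A 2 2 - A 1 2 * A 2 1)
  - A 0 1 * (A 1 0 * A 2 2 - A 1 2 * A 2 0)
  + A 0 2 * (A 1 0 * A 2 1 - A 1 1 * A 2 0).
Proof.
rewrite (expand_det_row _ 0) sum3E /cofactor !det2E !mxE.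
have e0 : lift (0 : 'I_3) 0 = 1 by apply/val_inj.
have e1 : lift (0 : 'I_3) 1 = 2 by apply/val_inj.
have e2 : lift (1 : 'I_3) 0 = 0 by apply/val_inj.
have e3 : lift (1 : 'I_3) 1 = 2 by apply/val_inj.
have e4 : lift (2 : 'I_3) 0 = 0 by apply/val_inj.
have e5 : lift (2 : 'I_3) 1 = 1 by apply/val_inj.
rewrite !(e0, e1, e2, e3, e4, e5) /= expr0 expr1.
ring.
Qed.

Lemma DeltaE (K : fieldType) (u m : 'rV[{mpoly K[3]}]_3) : Delta u m =
  'X_0 * (u 0 1 * m 0 2 - u 0 2 * m 0 1)
  - 'X_1 * (u 0 0 * m 0 2 - u 0 2 * m 0 0)
  + 'X_2 * (u 0 0 * m 0 1 - u 0 1 * m 0 0).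
Proof. by rewrite /Delta det3E !mxE. Qed.

Section Syzygies.
Variable K : fieldType.
Local Notation S := {mpoly K[3]}.
Implicit Types (f g h p q : S) (u m w : 'rV[S]_3).

Lemma euler_formula p k : p \is k.-homog ->
  \sum_(i < 3) 'X_i * p^`M(i) = k%:R *: p.
Proof.
move=> /dhomogP hp; rewrite (mpolyE p).
under eq_bigr => i _ do rewrite raddf_sum mulr_sumr.
rewrite exchange_big scaler_sumr; apply: eq_big_seq => x /hp /= <-.
under eq_bigr => i _.
  rewrite /= mderivZ mderivX -!scalerAr.
  over.
rewrite scalerA mulrC -scalerA -scaler_sumr; congr (_ *: _).
rewrite mdegE natr_sum scaler_suml; apply: eq_bigr => i _.
have [x0|x0] := posnP (x i); first by rewrite x0 !scale0r.
congr (_ *: _); rewrite -mpolyXD; congr 'X_[_].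
by rewrite addmC submK //; apply/mnm_lepP => j; rewrite mnm1E; case: eqP => // <-.
Qed.

Lemma syzygy_linear f a u m : syzygy f u -> syzygy f m -> syzygy f (a *: u + m).
Proof.
rewrite /syzygy => hu hm; under eq_bigr => i _ do rewrite !mxE mulrDl -mulrA.
by rewrite big_split -mulr_sumr hu hm /= mulr0 addr0.
Qed.

Lemma Delta_linear u a m w : Delta u (a *: m + w) = a * Delta u m + Delta u w.
Proof. by rewrite !DeltaE !mxE; ring. Qed.

Lemma DeltaZ u a m : Delta u (a *: m) = a * Delta u m.
Proof. by rewrite !DeltaE !mxE; ring. Qed.

Lemma Delta_linear2 u a b m w :
  Delta u (a *: m + b *: w) = a * Delta u m + b * Delta u w.
Proof. by rewrite Delta_linear DeltaZ. Qed.

Lemma Delta_self u : Delta u u = 0.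
Proof. by rewrite DeltaE; ring. Qed.

(** Both rows u and m are orthogonal to the gradient of f, hence their cross
    product is proportional to it; the Euler formula gives the factor. *)
Lemma Delta_deriv d f u m : f \is d.-homog -> syzygy f u -> syzygy f m ->
  [/\ Delta u m * f^`M(0) = (u 0 1 * m 0 2 - u 0 2 * m 0 1) * (d%:R *: f),
      Delta u m * f^`M(1) = (u 0 2 * m 0 0 - u 0 0 * m 0 2) * (d%:R *: f)
    & Delta u m * f^`M(2) = (u 0 0 * m 0 1 - u 0 1 * m 0 0) * (d%:R *: f)].
Proof.
move=> /euler_formula <-; rewrite /syzygy !sum3E DeltaE => hu hm.
set D := _ + 'X_2 * _.
(* Each identity is a combination of the two syzygy relations, with coefficients taken from the
   cross products of [u] and [m] with [(x, y, z)]. *)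
have comb a b : a * (u 0 0 * f^`M(0) + u 0 1 * f^`M(1) + u 0 2 * f^`M(2))
    + b * (m 0 0 * f^`M(0) + m 0 1 * f^`M(1) + m 0 2 * f^`M(2)) = 0.
  by rewrite hu hm !mulr0 addr0.
split; apply/eqP; rewrite -subr_eq0; apply/eqP.
- by rewrite -[RHS](comb ('X_2 * m 0 1 - 'X_1 * m 0 2) ('X_1 * u 0 2 - 'X_2 * u 0 1)) /D; ring.
- by rewrite -[RHS](comb ('X_0 * m 0 2 - 'X_2 * m 0 0) ('X_2 * u 0 0 - 'X_0 * u 0 2)) /D; ring.
- by rewrite -[RHS](comb ('X_1 * m 0 0 - 'X_0 * m 0 1) ('X_0 * u 0 1 - 'X_1 * u 0 0)) /D; ring.
Qed.

End Syzygies.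

Section ReducedCurves.
Variable K : numFieldType.
Local Notation S := {mpoly K[3]}.
Implicit Types (f h p q : S).

Lemma mderiv_eq0_const p : (forall i, p^`M(i) = 0) -> p = (p@_0%MM)%:MP.
Proof.
move=> dp; apply/mpolyP => x; rewrite mcoeffC.
have [->|x0] := eqVneq x 0%MM; first by rewrite mulr1.
rewrite mulr0.
have [i xi] : exists i, x i != 0%N.
  apply/existsP; apply: contraNT x0; rewrite negb_exists => /forallP h.
  by apply/eqP/mnmP => i; rewrite mnm0E; apply/eqP; rewrite -[_ == _]negbK.
have := congr1 (mcoeff (x - U_(i))%MM) (dp i).
rewrite mcoeff_deriv mcoeff0 => /eqP; rewrite mulrn_eq0 /= => /eqP.
by rewrite submK //; apply/mnm_lepP => j; rewrite mnm1E; case: eqP => // <-; rewrite lt0n.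
Qed.

Lemma msize_mulr p q : p != 0 -> q != 0 -> (msize p <= msize (q * p))%N.
Proof.
move=> p0 q0; rewrite msizeM // -(prednK (_ : 0 < msize q)%N) ?lt0n ?msize_poly_eq0 //.
by rewrite addSn leq_addl.
Qed.

(** A nonzero partial derivative has smaller degree than [p], so it is no multiple of [p]. If all of
    them vanish, then in characteristic zero [p] is a nonzero constant, hence a unit. *)
Lemma prime_dvdr_deriv p : prime_elt p -> exists i, ~ dvdr p p^`M(i).
Proof.
move=> [p0 pNu _]; apply: contrapT => /forallNP dp; case/negP: pNu.
have {}dp i : p^`M(i) = 0.
  apply/eqP/negPn/negP => dp0; have /contrapT[c cE] := dp i.
  have c0 : c != 0 by apply: contraNneq dp0 => c0; rewrite cE c0 mul0r.
  have := mleadc_eq0 (p^`M(i)); rewrite (negPf dp0) mcoeff_deriv mulrn_eq0 /=.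
  move=> /negbT; rewrite -mcoeff_msupp => /msize_mdeg_lt.
  rewrite mdegD mdeg1 addn1 mlead_deg // ltnNge => /negP; apply.
  by rewrite cE; exact: msize_mulr.
rewrite (mderiv_eq0_const dp) in p0 *.
apply: rmorph_unit; rewrite unitfE.
by apply: contraNneq p0 => ->; rewrite mpolyC0.
Qed.

(** Let [f = p * h] with [p] prime. Modulo [p], the product [q * f_i] is [q * p_i * h]; some [p_i]
    is prime to [p], and so is [h] because [f] is squarefree, whence [p] divides [q]. Squarefreeness
    again lets the primes be collected into their product. *)
Lemma reduced_dvdr d f q : reduced_curve d f ->
  (forall i, dvdr f (q * f^`M(i))) -> dvdr f q.
Proof.
move=> [d0 hf f0 fred] fq.
have sqfree p h : prime_elt p -> f <> p ^+ 2 * h.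
  move=> [p0 /negP pNu _] /fred[c cE]; apply: pNu; rewrite cE.
  apply: rmorph_unit; rewrite unitfE; apply: contraNneq p0 => c0.
  by rewrite cE c0 mpolyC0.
have [u [s [uu sp fE]]] := factorial_ring_mpoly f0.
have pq p h : prime_elt p -> f = p * h -> dvdr p q.
  move=> pp pf; have [i pi] := prime_dvdr_deriv pp.
  have [_ _ hp] := pp; have : dvdr p (q * f^`M(i)).
    by case: (fq i) => c ->; rewrite pf; apply/dvdr_mull/dvdr_mulr/dvdrr.
  case/hp => // -[c]; rewrite pf mderivM => cE.
  have : dvdr p (p^`M(i) * h).
    by exists (c - h^`M(i)); rewrite mulrBl -cE; ring.
  case/hp => // -[e eE]; case: (sqfree p e pp).
  by rewrite pf eE; ring.
suff : dvdr (\prod_(p <- s) p) q.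
  case=> c ->; exists (c / u); rewrite fE mulrA divrK //.
have : exists c, f = c * \prod_(p <- s) p by exists u.
elim: s sp {fE} => [|p s IHs] sp [c cE]; first by exists q; rewrite big_nil mulr1.
have pp : prime_elt p by apply: sp; rewrite mem_head.
rewrite big_cons in cE *.
have [||e eE] := IHs; first by move=> x xs; apply: sp; rewrite inE xs orbT.
  by exists (c * p); rewrite cE mulrA.
have : dvdr p q by apply: (pq _ (c * \prod_(p <- s) p)) => //; rewrite cE; ring.
rewrite eE; case: (pp) => _ _ hp /hp[[b bE]|[b bE]].
  by exists b; rewrite bE; ring.
by case: (sqfree p (c * b) pp); rewrite cE bE; ring.
Qed.

End ReducedCurves.

Section IntegerDegrees.
Variable K : fieldType.
Local Notation S := {mpoly K[3]}.
Implicit Types (p q f : S) (k i j : int) (u m : 'rV[S]_3).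

Lemma homogz0 k : homogz k (0 : S).
Proof. by case: k => [n|n] //; exact: dhomog0. Qed.

Lemma homogzD k p q : homogz k p -> homogz k q -> homogz k (p + q).
Proof.
by case: k => n /=; [exact: dhomogD | move=> -> ->; rewrite addr0].
Qed.

Lemma homogzN k p : homogz k p -> homogz k (- p).
Proof. by case: k => n /=; [rewrite dhomogN | move=> ->; rewrite oppr0]. Qed.

Lemma homogzM i j p q : homogz i p -> homogz j q -> homogz (i + j) (p * q).
Proof.
case: i => i /=; last by move=> -> _; rewrite mul0r; exact: homogz0.
case: j => j hp /=; last by move=> ->; rewrite mulr0; exact: homogz0.
exact: dhomogM.
Qed.

(** Rests on the homogeneity of factors; when [k < i] the conclusion says that [q] is 0. *)
Lemma homogz_mulIr (i : nat) k p q : p != 0 -> p \is i.-homog ->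
  homogz k (p * q) -> homogz (k - i%:Z) q.
Proof.
move=> p0 hp; have [->|q0] := eqVneq q 0; first by move=> _; exact: homogz0.
have pq0 : p * q != 0 by rewrite mulf_neq0.
case: k => k /= hpq; last by rewrite hpq eqxx in pq0.
have [i' [j [kE hp' hq]]] := dhomog_factor hpq pq0.
have ii' := dhomog_uniq p0 hp hp'.
by rewrite kE -ii' PoszD addrAC subrr add0r.
Qed.

Lemma homogz_uniq i j p : p != 0 -> homogz i p -> homogz j p -> i = j.
Proof.
case: i => i p0 /= hi; last by rewrite hi eqxx in p0.
case: j => j /= hj; last by rewrite hj eqxx in p0.
by rewrite (dhomog_uniq p0 hi hj).
Qed.

Lemma AR_scale f k j p m : homogz j p -> AR f k m -> AR f (j + k) (p *: m).
Proof.
move=> hp [hm sm]; split; first by move=> i; rewrite mxE; exact: homogzM.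
rewrite /syzygy; under eq_bigr => i _ do rewrite mxE -mulrA.
by rewrite -mulr_sumr sm mulr0.
Qed.

Lemma AR_add f k u m : AR f k u -> AR f k m -> AR f k (u + m).
Proof.
move=> [hu su] [hm sm]; split; first by move=> i; rewrite mxE; exact: homogzD.
rewrite /syzygy; under eq_bigr => i _ do rewrite !mxE mulrDl.
by rewrite big_split /= su sm addr0.
Qed.

Lemma AR0 f k : AR f k 0.
Proof.
split=> [i|]; first by rewrite mxE; exact: homogz0.
by rewrite /syzygy big1 // => i _; rewrite mxE mul0r.
Qed.

Lemma AR_uniq f i j m : m != 0 -> AR f i m -> AR f j m -> i = j.
Proof.
move=> /rV0Pn[t mt] [hi _] [hj _].
exact: homogz_uniq mt (hi t) (hj t).
Qed.

Lemma AR_divl f (l : S) k m : l != 0 -> l \is 1.-homog -> AR f k (l *: m) -> AR f (k - 1) m.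
Proof.
move=> l0 hl [hm sm]; split.
  by move=> i; apply: (homogz_mulIr (i := 1) l0 hl); have := hm i; rewrite mxE.
apply: (mulfI l0); rewrite mulr0 -[RHS]sm mulr_sumr.
by apply: eq_bigr => i _; rewrite mxE mulrA.
Qed.

End IntegerDegrees.

(** * The syzygy [rho1] and the kernel of [v] *)

Section MinimalSyzygy.
Variables (K : numFieldType) (d r : nat) (f : {mpoly K[3]}).
Variable rho1 : 'rV[{mpoly K[3]}]_3.
Hypotheses (hf : reduced_curve d f) (hr : is_mdr f r).
Hypotheses (hrho1 : AR f r%:Z rho1) (rho1_neq0 : rho1 != 0).
Local Notation S := {mpoly K[3]}.
Implicit Types (b h p : S) (m w : 'rV[S]_3).

Lemma f_neq0 : f != 0. Proof. by case: hf. Qed.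

Lemma f_homog : f \is d.-homog. Proof. by case: hf. Qed.

Lemma natd_unit : (d%:R : S) \is a GRing.unit.
Proof.
have d0 : (0 < d)%N by case: hf.
by rewrite -mpolyC_nat; apply: rmorph_unit; rewrite unitfE pnatr_eq0 -lt0n.
Qed.

(** The existence of [v]: the products of the determinant with all three partials are multiples of
    [f], and the curve is reduced. *)
Lemma dvdr_Delta m : syzygy f m -> exists b, Delta rho1 m = b * f.
Proof.
move=> sm; have [_ s1] := hrho1; apply: (reduced_dvdr hf) => i.
have [e0 e1 e2] := Delta_deriv f_homog s1 sm.
have dvdf (a : S) : dvdr f (a * (d%:R *: f)).
  by exists (a * d%:R%:MP); rewrite -mulrA mul_mpolyC.
have : [|| i == 0, i == 1 | i == 2] by case: i => -[|[|[|]]].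
by case/or3P => /eqP ->; rewrite ?e0 ?e1 ?e2.
Qed.

Lemma homogz_Delta k m b : AR f k m -> Delta rho1 m = b * f ->
  homogz (k + r%:Z + 1 - d%:Z) b.
Proof.
move=> [hm _] bE; have [h1 _] := hrho1.
have hX (i : 'I_3) p : homogz (k + r%:Z) p -> homogz (k + r%:Z + 1) ('X_i * p).
  rewrite [_ + 1]addrC; apply: homogzM => /=.
  by rewrite dhomogX /= mdeg1.
have hminor i j : homogz (k + r%:Z) (rho1 0 i * m 0 j - rho1 0 j * m 0 i).
  by apply: homogzD; [|apply: homogzN]; rewrite addrC; apply: homogzM.
apply: (homogz_mulIr f_neq0 f_homog); rewrite mulrC -bE DeltaE.
by apply: homogzD; [apply: homogzD; [|apply: homogzN]|]; apply: hX.
Qed.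

(** A prime has positive degree, being no unit; dividing it out would leave a nonzero syzygy of
    degree below [r = mdr(f)]. *)
Lemma rho1_no_prime_factor p w : prime_elt p -> rho1 <> p *: w.
Proof.
move=> [p0 pNu _] rho1E; have [h1 s1] := hrho1.
have w0 : w != 0 by apply: contraNneq rho1_neq0 => w0; rewrite rho1E w0 scaler0.
have /rV0Pn[i w_i] := w0.
have [e [j [rE hp hw]]] : exists e j, [/\ r = (e + j)%N, p \is e.-homog & w 0 i \is j.-homog].
  by apply: dhomog_factor; [have := h1 i; rewrite rho1E mxE | rewrite mulf_neq0].
have e0 : (0 < e)%N.
  rewrite lt0n; apply: contra pNu => /eqP e0; rewrite e0 in hp.
  have pE : p = (p@_0%MM)%:MP.
    apply: msize1_polyC; rewrite msizeE.
    by apply/bigmax_leqP_seq => t /(dhomogP _ _ _ hp) /= ->.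
  rewrite pE; apply: rmorph_unit; rewrite unitfE.
  by apply: contraNneq p0 => p00; rewrite pE p00 mpolyC0.
case: hr => _ /(_ j); rewrite rE -{1}[j]add0n ltn_add2r => /(_ e0 w) wE.
case/eqP: w0; apply: wE.
split.
  move=> t; have -> : j%:Z = r%:Z - e%:Z by lia.
  by apply: (homogz_mulIr p0 hp); have := h1 t; rewrite rho1E mxE.
apply: (mulfI p0); rewrite mulr0 -[RHS]s1 mulr_sumr rho1E.
by apply: eq_bigr => t _; rewrite mxE mulrA.
Qed.

(** As [d] is invertible, the vanishing of [Delta] kills all 2 by 2 minors of [rho1] and [m]; the
    two are then proportional, and [rho1] has no prime factor. *)
Lemma Delta_eq0 m : syzygy f m -> Delta rho1 m = 0 -> exists h, m = h *: rho1.
Proof.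
move=> sm D0; have [_ s1] := hrho1.
have [e0 e1 e2] := Delta_deriv f_homog s1 sm.
have df0 : d%:R *: f != 0.
  rewrite -mul_mpolyC mulf_neq0 ?f_neq0 // mpolyC_nat.
  by apply: contraTneq natd_unit => ->; rewrite unitr0.
have {e0 e1 e2} [c0 c1 c2] : [/\ rho1 0 1 * m 0 2 - rho1 0 2 * m 0 1 = 0,
    rho1 0 2 * m 0 0 - rho1 0 0 * m 0 2 = 0
  & rho1 0 0 * m 0 1 - rho1 0 1 * m 0 0 = 0].
  by split; apply: (mulIf df0); rewrite mul0r -?e0 -?e1 -?e2 D0 mul0r.
have /rV0Pn[j r1j] := rho1_neq0.
have cross i k : rho1 0 k * m 0 i - m 0 k * rho1 0 i = 0.
{ have ho (t : 'I_3) : [|| t == 0, t == 1 | t == 2] by case: t => -[|[|[|]]].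
  case/or3P: (ho i) => /eqP ->; case/or3P: (ho k) => /eqP ->.
  all: try (by ring).
  all: first [by rewrite -[RHS]c0; ring | by rewrite -[RHS]c1; ring | by rewrite -[RHS]c2; ring
    | apply: oppr_inj; rewrite oppr0].
  all: first [by rewrite -[RHS]c0; ring | by rewrite -[RHS]c1; ring
    | by rewrite -[RHS]c2; ring]. }
apply: (proportional_multiple (q := rho1 0 j) (p := m 0 j) _ r1j).
- exact: factorial_ring_mpoly.
- by apply/rowP => i; rewrite !mxE; apply/eqP; rewrite -subr_eq0 cross.
- exact: rho1_no_prime_factor.
Qed.

Lemma AR_multiple k h : AR f k (h *: rho1) -> homogz (k - r%:Z) h.
Proof.
have [h1 _] := hrho1.
have /rV0Pn[j r1j] := rho1_neq0.
case=> /(_ j) + _; rewrite mxE mulrC; exact: (homogz_mulIr r1j (h1 j)).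
Qed.

End MinimalSyzygy.

(** * Restriction to a line *)

Section Line.
Variables (K : fieldType) (M : 'M[K]_3).
Hypothesis Mu : M \in unitmx.
Local Notation S := {mpoly K[3]}.
Local Notation N := (invmx M).
Implicit Types (p q : S) (u v : {poly K}).

(** The rows of the invertible [M] serve as linear coordinates, the first one cutting out the
    line. *)
Definition lform (j : 'I_3) : S := line_eq (row j M).

(** On the line lform 0 = 0, in the affine coordinate lform 2 / lform 1. *)
Definition restr : {rmorphism S -> {poly K}} :=
  mmap polyC (fun i => (N i 1)%:P + N i 2 *: 'X).

Lemma restrC c : restr c%:MP = c%:P.
Proof. exact: mmapC. Qed.

Lemma restrX i : restr 'X_i = (N i 1)%:P + N i 2 *: 'X.
Proof. by rewrite /= mmapX mmap1U. Qed.

Lemma restrZ c p : restr (c *: p) = c *: restr p.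
Proof. by rewrite -mul_mpolyC rmorphM restrC mul_polyC. Qed.

Lemma restr_lform j : restr (lform j) = (j == 1)%:R%:P + (j == 2)%:R *: 'X.
Proof.
rewrite /lform /line_eq rmorph_sum.
under eq_bigr => i _ do rewrite restrZ restrX mxE scalerDr scalerA -mul_polyC -polyCM.
rewrite big_split -rmorph_sum -scaler_suml /=.
have MN : M *m N = 1%:M by exact: mulmxV.
have h k : \sum_i M j i * N i k = (j == k)%:R.
  by move: MN => /matrixP/(_ j k); rewrite !mxE.
by rewrite !h.
Qed.

Lemma restr_lform0 : restr (lform 0) = 0.
Proof. by rewrite restr_lform scale0r addr0. Qed.

Lemma restr_lform1 : restr (lform 1) = 1.
Proof. by rewrite restr_lform scale0r addr0. Qed.

Lemma restr_lform2 : restr (lform 2) = 'X.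
Proof. by rewrite restr_lform scale1r add0r. Qed.

Lemma line_eq_homog (a : 'rV[K]_3) : line_eq a \is 1.-homog.
Proof. by apply: rpred_sum => i _; rewrite dhomogZ // dhomogX /= mdeg1. Qed.

Lemma lform_homog j : lform j \is 1.-homog.
Proof. exact: line_eq_homog. Qed.

Lemma X_lform i : 'X_i = N i 0 *: lform 0 + N i 1 *: lform 1 + N i 2 *: lform 2.
Proof.
transitivity (\sum_j N i j *: lform j); last exact: sum3E.
rewrite /lform /line_eq.
under eq_bigr => j _ do rewrite scaler_sumr.
rewrite exchange_big (bigD1 i) //= [X in _ + X]big1 => [|k ki].
  under eq_bigr => j _ do rewrite scalerA mxE.
  rewrite -scaler_suml; have := mulVmx Mu => /matrixP/(_ i i); rewrite !mxE eqxx => ->.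
  by rewrite scale1r addr0.
under eq_bigr => j _ do rewrite scalerA mxE.
rewrite -scaler_suml; have := mulVmx Mu => /matrixP/(_ i k).
rewrite !mxE eq_sym (negPf ki) => ->.
by rewrite scale0r.
Qed.

Lemma lform_neq0 j : lform j != 0.
Proof.
apply/eqP => l0; have : row j M = 0.
  apply/rowP => i; have := congr1 (mcoeff U_(i)) l0.
  rewrite /lform /line_eq raddf_sum /= mcoeff0 (bigD1 i) //= big1 => [|k ki].
    by rewrite mcoeffZ mcoeffX eqxx mulr1 addr0 !mxE.
  by rewrite mcoeffZ mcoeffX eq_mnm1 (negPf ki) mulr0.
move=> r0; have /matrixP/(_ j j) := mulmxV Mu; rewrite !mxE eqxx.
rewrite big1 => [/esym/eqP|i _]; first by rewrite oner_eq0.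
by move/rowP/(_ i): r0; rewrite !mxE => ->; rewrite mul0r.
Qed.

(** A lift of [u] to degree [k] when [u] has degree at most [k], since [restr] sends [lform 1] to 1
    and [lform 2] to ['X]. *)
Definition homogen k u : S := \sum_(j < k.+1) u`_j *: (lform 1 ^+ (k - j) * lform 2 ^+ j).

Lemma homogen_homog k u : homogen k u \is k.-homog.
Proof.
apply: rpred_sum => j _; apply: dhomogZ.
have jk : (1 * (k - j) + 1 * j)%N = k by rewrite !mul1n subnK // -ltnS.
by rewrite -[X in X.-homog]jk; apply: dhomogM; apply: dhomogMn; exact: lform_homog.
Qed.

Lemma restr_homogen k u : (size u <= k.+1)%N -> restr (homogen k u) = u.
Proof.
move=> uk; transitivity (\poly_(j < k.+1) u`_j).
  rewrite poly_def rmorph_sum; apply: eq_bigr => j _.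
  by rewrite restrZ rmorphM !rmorphXn restr_lform1 restr_lform2 expr1n mul1r.
apply/polyP => j; rewrite coef_poly; case: ltnP => // kj.
by rewrite nth_default // (leq_trans uk).
Qed.

Lemma homogenD k u v : homogen k (u + v) = homogen k u + homogen k v.
Proof. by rewrite -big_split; apply: eq_bigr => j _; rewrite coefD scalerDl. Qed.

Lemma homogenZ k c u : homogen k (c *: u) = c *: homogen k u.
Proof. by rewrite scaler_sumr; apply: eq_bigr => j _; rewrite coefZ scalerA. Qed.

Lemma homogenS1 k u : (size u <= k.+1)%N -> homogen k.+1 u = lform 1 * homogen k u.
Proof.
move=> uk; rewrite /homogen big_ord_recr /= nth_default // scale0r addr0 mulr_sumr.
by apply: eq_bigr => j _; rewrite subSn -1?ltnS // exprS -!scalerAr mulrA.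
Qed.

Lemma homogenS2 k u : homogen k.+1 ('X * u) = lform 2 * homogen k u.
Proof.
rewrite /homogen big_ord_recl coefXM eqxx scale0r add0r mulr_sumr.
apply: eq_bigr => j _; rewrite coefXM lift0 /= subSS exprS -!scalerAr.
by congr (_ *: _); ring.
Qed.

(** Modulo [lform 0] every form is a form in [lform 1] and [lform 2]: induction on the degree of a
    monomial, expanding one variable by [X_lform]. Hence a form that restricts to 0 is a multiple of
    [lform 0]. *)
Lemma homogen_restr k p : p \is k.-homog -> 
  (size (restr p) <= k.+1)%N /\ exists w, p = homogen k (restr p) + lform 0 * w.
Proof.
pose P q := (size (restr q) <= k.+1)%N /\ exists w, q = homogen k (restr q) + lform 0 * w.
move=> /dhomogP hp; rewrite -/(P p) (mpolyE p) big_seq.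
apply: big_ind => [|q q'|x /hp /= {hp}].
- rewrite /P rmorph0 size_poly0; split=> //; exists 0.
  by rewrite mulr0 addr0 /homogen big1 // => j _; rewrite coef0 scale0r.
- move=> [sq [w qE]] [sq' [w' q'E]]; rewrite /P rmorphD; split.
    by rewrite (leq_trans (size_polyD _ _)) // geq_max sq.
  by exists (w + w'); rewrite homogenD {1}qE {1}q'E; ring.
set c := p@_x; move=> xk; suff [sx [w xE]] : P 'X_[x].
  rewrite /P restrZ; split; first exact: leq_trans (size_scale_leq _ _) sx.
  by exists (c *: w); rewrite homogenZ {1}xE scalerDr -scalerAr.
rewrite {}/P {c p}; move: xk.
elim: k x => [|k IHk] x.
  move=> /eqP; rewrite mdeg_eq0 => /eqP ->; rewrite mpolyX0 rmorph1 size_poly1; split=> //.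
  by exists 0; rewrite mulr0 addr0 /homogen big_ord1 coef1 scale1r mulr1.
move=> xk; have [i xi] : exists i, x i != 0%N.
  apply/existsP; apply: contraPT xk; rewrite negb_exists => /forallP h.
  have -> : x = 0%MM by apply/mnmP => i; rewrite mnm0E; apply/eqP; rewrite -[_ == _]negbK.
  by rewrite mdeg0.
have xE : x = (U_(i) + (x - U_(i)))%MM.
  rewrite addmC submK //; apply/mnm_lepP => j.
  by rewrite mnm1E; case: eqP => // <-; rewrite lt0n.
have /IHk[sy [w wE]] : mdeg (x - U_(i))%MM = k.
  by apply: succn_inj; rewrite -xk [in RHS]xE mdegD mdeg1 add1n.
rewrite xE mpolyXD rmorphM restrX; set y := restr _ in sy wE *.
have syX : (size (('X : {poly K}) * y)%R <= k.+2)%N.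
  by rewrite mulrC (leq_trans (size_polyMleq _ _)) // size_polyX addn2 /= ltnS.
rewrite mulrDl mul_polyC -scalerAl; split.
  rewrite (leq_trans (size_polyD _ _)) // geq_max !(leq_trans (size_scale_leq _ _)) //.
  exact: leqW.
rewrite homogenD !homogenZ homogenS1 // homogenS2 {1}X_lform wE.
exists (N i 0 *: 'X_[x - U_(i)] + (N i 1 *: lform 1 + N i 2 *: lform 2) * w).
by rewrite {1}wE -!mul_mpolyC; ring.
Qed.

End Line.

Section DegreeBounds.
Variable R : comNzRingType.
Implicit Types (u v : {poly R}) (i j k : int).

(** The degree of u is at most k; for k < 0 this means u = 0. *)
Definition degz k u := forall n : nat, k < n%:Z -> u`_n = 0.

Lemma degz_size (k : nat) u : degz k%:Z u <-> (size u <= k.+1)%N.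
Proof.
split=> [h|/leq_sizeP h n]; last by rewrite ltz_nat; exact: h.
by apply/leq_sizeP => n kn; apply: h; lia.
Qed.

Lemma degz_lt0 k u : k < 0 -> degz k u -> u = 0.
Proof. by move=> k0 h; apply/polyP => n; rewrite coef0; apply: h; lia. Qed.

Lemma degz0 k : degz k 0.
Proof. by move=> n _; rewrite coef0. Qed.

Lemma degzN k u : degz k u -> degz k (- u).
Proof. by move=> hu n kn; rewrite coefN hu // oppr0. Qed.

Lemma degzM i j u v : degz i u -> degz j v -> degz (i + j) (u * v).
Proof.
move=> hu hv n ijn; rewrite coefM big1 // => -[a /= an] _.
have [ia|ai] := ltP i a%:Z; first by rewrite hu // mul0r.
by rewrite hv ?mulr0 //; lia.
Qed.

Lemma degzXn (n : nat) k u : degz (n%:Z + k) ('X^n * u) <-> degz k u.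
Proof.
split=> h a ka.
  by have := h (n + a)%N; rewrite coefXnM ltnNge leq_addr addKn; apply; lia.
by rewrite coefXnM; case: ltnP => // na; apply: h; lia.
Qed.

End DegreeBounds.

(** * Graded modules restricted to the line *)

Section RestrictedModules.
Variables (K : fieldType) (M : 'M[K]_3).
Hypothesis Mu : M \in unitmx.
Local Notation S := {mpoly K[3]}.
Local Notation N := (invmx M).
Local Notation lf := (lform M).
Local Notation "p ^R" := (map_mx (restr M) p) (at level 2, format "p ^R").
Implicit Types (p q g : S) (u v : {poly K}) (k j : int).

Definition homogenz k u : S := if k is Posz n then homogen M n u else 0.

Lemma homogenz_homogz k u : homogz k (homogenz k u).
Proof. by case: k => n //=; exact: homogen_homog. Qed.

Lemma restr_homogenz k u : degz k u -> restr M (homogenz k u) = u.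
Proof.
case: k => n; first by move/degz_size; exact: restr_homogen.
by move=> h; rewrite rmorph0 [RHS](degz_lt0 _ h).
Qed.

Lemma restr_degz k p : homogz k p -> degz k (restr M p).
Proof.
case: k => n /=; last by move=> ->; rewrite rmorph0; exact: degz0.
by case/(homogen_restr Mu) => sp _; apply/degz_size.
Qed.

Lemma restr_eq0 k p : homogz k p -> restr M p = 0 ->
  exists2 w, homogz (k - 1) w & p = lf 0 * w.
Proof.
move=> hp p0; case: k hp => k hp; last first.
  by exists 0; [exact: homogz0 | rewrite mulr0].
have [_ [w pE]] := homogen_restr Mu hp.
have {}pE : p = lf 0 * w.
  rewrite pE p0 /homogen big1 ?add0r // => j _; last by rewrite coef0 scale0r.
exists w => //; apply: (homogz_mulIr (i := 1) (lform_neq0 Mu 0)); first exact: lform_homog.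
by rewrite -pE.
Qed.

Lemma horner_restr p t : (restr M p).[t] = p.@[fun i => N i 1 + N i 2 * t].
Proof.
move: p; apply: (eq_mpoly_rmorph (phi := (horner_eval t \o restr M)%FUN)
  (psi := meval (fun i => N i 1 + N i 2 * t))) => [c|i].
  change ((restr M c%:MP).[t] = c%:MP.@[fun i => N i 1 + N i 2 * t]).
  by rewrite mevalC restrC hornerC.
change ((restr M 'X_i).[t] = ('X_i).@[fun i => N i 1 + N i 2 * t]).
by rewrite mevalXU restrX !hornerE.
Qed.

Lemma meval_lform (j i : 'I_3) : (lf j).@[fun t => N t i] = (j == i)%:R.
Proof.
rewrite /lform /line_eq rmorph_sum /=; under eq_bigr => t _ do rewrite mevalZ mevalXU mxE.
by have /matrixP/(_ j i) := mulmxV Mu; rewrite !mxE.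
Qed.

(** The coefficient of [t^n] is the value at the point of the line outside the chart, where
    [lform 1] vanishes and [lform 2] is 1. *)
Lemma lead_restr n p : p \is n.-homog -> (restr M p)`_n = p.@[fun i => N i 2].
Proof.
move=> hp; have [_ [w {2}->]] := homogen_restr Mu hp.
rewrite mevalD mevalM meval_lform mul0r addr0 /homogen rmorph_sum /=.
rewrite (bigD1 ord_max) //= big1 => [|j jn]; rewrite mevalZ mevalM !rmorphXn /= !meval_lform.
  by rewrite subnn expr0 expr1n !mulr1 addr0.
have {}jn : (j < n)%N by move: jn; rewrite -val_eqE /= ltn_neqAle -ltnS ltn_ord => ->.
by rewrite expr0n subn_eq0 leqNgt jn mul0r mulr0.
Qed.

(** A graded submodule P of a free module such that P /\ l S^n = l P. *)
Record saturated n (P : gpieces 'rV[S]_n) : Prop := Saturated {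
  sat_add : forall k m w, P k m -> P k w -> P k (m + w);
  sat_scale : forall k j p m, homogz j p -> P k m -> P (j + k) (p *: m);
  sat_div : forall k m, P k m -> m^R = 0 -> exists2 w, P (k - 1) w & m = lf 0 *: w
}.

Lemma restr_row_eq0 n (k : 'I_n -> int) (m : 'rV[S]_n) :
  (forall i, homogz (k i) (m 0 i)) -> m^R = 0 ->
  exists2 w : 'rV[S]_n, (forall i, homogz (k i - 1) (w 0 i)) & m = lf 0 *: w.
Proof.
move=> hm m0; have wP i : exists w, homogz (k i - 1) w /\ m 0 i = lf 0 * w.
  have [|w hw wE] := restr_eq0 (hm i); last by exists w.
  by move/rowP/(_ i): m0; rewrite !mxE.
exists (\row_i projT1 (cid (wP i))) => [i|].
  by rewrite mxE; case: (projT2 (cid (wP i))).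
by apply/rowP => i; rewrite !mxE; case: (projT2 (cid (wP i))).
Qed.

Lemma AR_saturated (f : S) : saturated (AR f).
Proof.
split=> [k m w|k j p m|k m hm m0]; [exact: AR_add|exact: AR_scale|].
have [w _ mE] := restr_row_eq0 (k := fun=> k) (fst hm) m0.
by exists w => //; apply: (AR_divl (lform_neq0 Mu 0) (lform_homog _ _)); rewrite -mE.
Qed.

Lemma twist2_saturated d1 d2 : saturated (twist2 d1 d2 : gpieces 'rV[S]_2).
Proof.
split=> [k m w [h0 h1] [h0' h1']|k j p m hp [h0 h1]|k m [h0 h1] m0].
- by split; rewrite mxE; apply: homogzD.
- by split; rewrite mxE -addrA; apply: homogzM.
have [|w hw mE] := restr_row_eq0 (k := fun i : 'I_2 => if i == 0 then k - d1 else k - d2) _ m0.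
  move=> i; have : (i == 0) || (i == 1) by case: i => -[|[]].
  by case/orP => /eqP ->.
exists w => //; split; first by rewrite addrAC; exact: (hw 0).
by rewrite addrAC; exact: (hw 1).
Qed.

(** Saturation turns membership in [l M] into vanishing of the restriction. Since [K[t]] is a
    domain, one factor [restr M g] stands for all powers of [g]; it is kept because [g] may vanish
    on the line, in which case all sections are equal. *)
Lemma sec_eqE n (P : gpieces 'rV[S]_n) e g (u v : 'rV[S]_n * nat) :
  saturated P -> g \is e.-homog -> is_sec P e u -> is_sec P e v ->
  sec_eq P (lf 0) e g u v <->
  restr M g *: (restr M g ^+ v.2 *: u.1^R - restr M g ^+ u.2 *: v.1^R) = 0.
Proof.
move=> Psat hg hu hv.
have restrE (k : nat) : (g ^+ k *: (g ^+ v.2 *: u.1 - g ^+ u.2 *: v.1))^R =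
    restr M g ^+ k *: (restr M g ^+ v.2 *: u.1^R - restr M g ^+ u.2 *: v.1^R).
  by rewrite map_mxZ map_mxB !map_mxZ !rmorphXn.
split=> [[k [w _ /(congr1 (map_mx (restr M)))]]|/= h].
  rewrite restrE map_mxZ restr_lform0 // scale0r => /eqP.
  case: k => [|k]; first by rewrite scale1r => /eqP ->; rewrite scaler0.
  rewrite scalemx_eq0 expf_eq0 /= => /orP[/eqP ->|/eqP ->]; by rewrite ?scale0r ?scaler0.
exists 1%N; apply: (sat_div Psat); last by rewrite restrE.
have hgn (j : nat) : homogz (j * e)%N%:Z (g ^+ j) by rewrite mulnC; exact: dhomogMn.
have hg1 : homogz (1 * e)%N%:Z g by rewrite mul1n.
rewrite expr1 -addnA mulnDl PoszD; apply: (sat_scale Psat hg1).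
rewrite -scaleN1r; apply: (sat_add Psat).
  by rewrite addnC mulnDl PoszD; apply: (sat_scale Psat).
rewrite -[(_ * e)%N%:Z]add0r; apply: (sat_scale Psat); first by rewrite /= dhomogN dhomog1.
by rewrite mulnDl PoszD; apply: (sat_scale Psat).
Qed.

End RestrictedModules.

(** * Sections on a line *)

Section PowersOfX.
Variables (K : fieldType) (n : nat).
Implicit Types (m w : 'rV[{poly K}]_n) (a b c : nat).

Lemma scaleXn_shift c a b m w : 'X^a *: m = 'X^b *: w ->
  'X^(a + c) *: m = 'X^(b + c) *: w.
Proof. by move=> e; rewrite [in LHS]addnC [in RHS]addnC !exprD -!scalerA e. Qed.

Lemma scaleXn_unshift c a b m w : 'X^(a + c) *: m = 'X^(b + c) *: w ->
  'X^a *: m = 'X^b *: w.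
Proof.
rewrite [in X in X -> _]addnC [in X in _ = X -> _]addnC !exprD -!scalerA => /eqP.
rewrite -subr_eq0 -scalerBr scalemx_eq0 expf_eq0 polyX_eq0 andbF /= subr_eq0.
by move/eqP.
Qed.

(** Bookkeeping for [glue_phi]: [A], [B], [C] are numerators over the overlap of the two charts,
    [W1] and [W2] those over each chart, and the powers of ['X] come from cleared denominators and
    from the transition function of the twist. *)
Lemma scaleXn_glue (A B C W1 W2 : 'rV[{poly K}]_n) (a b c v w k1 k2 : nat) :
  'X^(k1 + k2 + b) *: A = 'X^(a + k2.*2) *: B -> 'X^w *: B = 'X^(b + w) *: W1 ->
  'X^v *: C = 'X^c *: W2 ->
  'X^c *: A = 'X^a *: C <-> 'X^k1 *: W2 = 'X^(v + k2) *: W1.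
Proof.
move=> hA hB hC.
have {}hA : 'X^(k1 + k2) *: A = 'X^(a + k2.*2) *: W1.
  apply: (@scaleXn_unshift (b + w)); rewrite addnA.
  rewrite (scaleXn_shift w hA); apply: etrans (_ : 'X^(w + (a + k2.*2)) *: B = _).
    by congr ('X^_ *: _); lia.
  by rewrite (scaleXn_shift _ hB); congr ('X^_ *: _); lia.
split=> h.
- apply: (@scaleXn_unshift (a + c + k2)).
  have -> : (k1 + (a + c + k2) = c + (a + k1 + k2))%N by lia.
  rewrite -(scaleXn_shift _ hC).
  have -> : (v + (a + k1 + k2) = a + (v + k1 + k2))%N by lia.
  rewrite -(scaleXn_shift _ h).
  have -> : (c + (v + k1 + k2) = k1 + k2 + (c + v))%N by lia.
  by rewrite (scaleXn_shift _ hA); congr ('X^_ *: _); lia.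
- apply: (@scaleXn_unshift (k1 + k2 + v)).
  have -> : (c + (k1 + k2 + v) = k1 + k2 + (c + v))%N by lia.
  rewrite (scaleXn_shift _ hA).
  have -> : (a + k2.*2 + (c + v) = v + k2 + (a + c + k2))%N by lia.
  rewrite -(scaleXn_shift _ h).
  have -> : (k1 + (a + c + k2) = c + (a + k1 + k2))%N by lia.
  by rewrite -(scaleXn_shift _ hC); congr ('X^_ *: _); lia.
Qed.

End PowersOfX.

(** * Global sections of twists, transported by a sheaf isomorphism *)

Section GlobalSections.
Variables (K : fieldType) (M : 'M[K]_3).
Hypothesis Mu : M \in unitmx.
Local Notation S := {mpoly K[3]}.
Local Notation lf := (lform M).
Local Notation "p ^R" := (map_mx (restr M) p) (at level 2, format "p ^R").

(** x is a global section on the line of the twist by k1 - k2 of the sheaf of P,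
    written in the chart lf 1 != 0; u1 and u2 are its restrictions to the two
    charts, up to the factors (lf 1)^(k1 - k2) and (lf 2)^(k1 - k2). *)
Definition glob n (P : gpieces 'rV[S]_n) k1 k2 (x : 'rV[{poly K}]_n) : Prop :=
  exists u1 u2 : 'rV[S]_n * nat,
    [/\ is_sec P 1 u1, is_sec P 1 u2, u1.1^R = x
      & 'X^k1 *: u2.1^R = 'X^(u2.2 + k2) *: x].

Lemma sec_eq1 n (P : gpieces 'rV[S]_n) u v : saturated M P ->
  is_sec P 1 u -> is_sec P 1 v -> sec_eq P (lf 0) 1 (lf 1) u v <-> u.1^R = v.1^R.
Proof.
move=> Psat hu hv; rewrite (sec_eqE Mu Psat) ?lform_homog // restr_lform1 //.
rewrite !expr1n !scale1r; split=> [/eqP|->]; last by rewrite subrr.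
by rewrite subr_eq0 => /eqP.
Qed.

Lemma sec_eqX n (P : gpieces 'rV[S]_n) e g u v : saturated M P ->
  g \is e.-homog -> restr M g = 'X -> is_sec P e u -> is_sec P e v ->
  sec_eq P (lf 0) e g u v <-> 'X^(v.2) *: u.1^R = 'X^(u.2) *: v.1^R.
Proof.
move=> Psat hg gX hu hv; rewrite (sec_eqE Mu Psat) // gX.
split=> [/eqP|->]; last by rewrite subrr scaler0.
by rewrite scalemx_eq0 polyX_eq0 /= subr_eq0 => /eqP.
Qed.

Lemma is_sec_res n (P : gpieces 'rV[S]_n) e e' h u : saturated M P -> h \is e'.-homog ->
  is_sec P e u -> is_sec P (e + e') (sec_res h u).
Proof.
move=> Psat hh hu; rewrite /is_sec /= mulnDr addnC PoszD.
by apply: (sat_scale Psat) hu; rewrite mulnC; exact: dhomogMn.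
Qed.

Lemma is_sec_scale n (P : gpieces 'rV[S]_n) e (s : S * nat) u : saturated M P ->
  s.1 \is (s.2 * e).-homog -> is_sec P e u -> is_sec P e (sec_scale s u).
Proof.
by move=> Psat hs hu; rewrite /is_sec /= mulnDl PoszD; apply: (sat_scale Psat) hu.
Qed.

Lemma is_sec_add n (P : gpieces 'rV[S]_n) e g u v : saturated M P ->
  g \is e.-homog -> is_sec P e u -> is_sec P e v -> is_sec P e (sec_add g u v).
Proof.
move=> Psat hg hu hv; rewrite /is_sec /= mulnDl PoszD; apply: (sat_add Psat).
  by rewrite addrC; apply: (sat_scale Psat) hu; rewrite mulnC; exact: dhomogMn.
by apply: (sat_scale Psat) hv; rewrite mulnC; exact: dhomogMn.
Qed.

Variables (n m : nat) (P : gpieces 'rV[S]_n) (Q : gpieces 'rV[S]_m).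
Hypotheses (Psat : saturated M P) (Qsat : saturated M Q).
Variable phi : S -> 'rV[S]_n * nat -> 'rV[S]_m * nat.
Hypothesis phiS : sheaf_iso_on_line P Q (lf 0) phi.

(** The map on sections over the chart [lform 1 != 0], seen on restricted numerators; these
    determine a section there because [lform 1] restricts to 1. It is a relation because [phi] acts
    on representatives. *)
Definition glob_rel (x : 'rV[{poly K}]_n) (y : 'rV[{poly K}]_m) : Prop :=
  exists u, [/\ is_sec P 1 u, u.1^R = x & (phi (lf 1) u).1^R = y].

Lemma glob_rel_inj x y x' y' : glob_rel x y -> glob_rel x' y' -> x = x' <-> y = y'.
Proof.
move=> [u [hu <- <-]] [v [hv <- <-]].
have hl := lform_homog M 1.
rewrite -(sec_eq1 Psat hu hv) (siso_inj phiS _ hl hu hv) // sec_eq1 //;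
  exact: (siso_sec phiS).
Qed.

Lemma glob_relD x y x' y' : glob_rel x y -> glob_rel x' y' ->
  glob_rel (x + x') (y + y').
Proof.
move=> [u [hu <- <-]] [v [hv <- <-]]; have hl := lform_homog M 1.
have hu' := siso_sec phiS (ltn0Sn _) hl hu; have hv' := siso_sec phiS (ltn0Sn _) hl hv.
have huv := is_sec_add Psat hl hu hv.
exists (sec_add (lf 1) u v); split=> //.
  by rewrite map_mxD !map_mxZ !rmorphXn restr_lform1 // !expr1n !scale1r.
have huv' := is_sec_add Qsat hl hu' hv'.
have := siso_add phiS (ltn0Sn _) hl hu hv.
move/(sec_eq1 Qsat (siso_sec phiS (ltn0Sn _) hl huv) huv') => ->.
by rewrite map_mxD !map_mxZ !rmorphXn restr_lform1 // !expr1n !scale1r.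
Qed.

Lemma glob_relZ (c : K) x y : glob_rel x y -> glob_rel (c%:P *: x) (c%:P *: y).
Proof.
move=> [u [hu <- <-]]; have hl := lform_homog M 1.
have hu' := siso_sec phiS (ltn0Sn _) hl hu.
have hc : ((c%:MP : S), 0%N).1 \is (((c%:MP : S), 0%N).2 * 1).-homog.
  by rewrite /= -[c%:MP]mulr1 mul_mpolyC dhomogZ ?dhomog1.
have hcu := is_sec_scale Psat hc hu.
exists (sec_scale (c%:MP, 0%N) u); split=> //.
  by rewrite map_mxZ /= restrC.
have hcu' := is_sec_scale Qsat hc hu'.
have := siso_scale phiS (ltn0Sn _) hl hc hu.
move/(sec_eq1 Qsat (siso_sec phiS (ltn0Sn _) hl hcu) hcu') => ->.
by rewrite map_mxZ /= restrC.
Qed.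

(** Comparing over the intersection of the two charts. *)
Lemma glue_phi k1 k2 u1 u2 : is_sec P 1 u1 -> is_sec P 1 u2 ->
  let w1 := phi (lf 1) u1 in let w2 := phi (lf 2) u2 in
  'X^k1 *: u2.1^R = 'X^(u2.2 + k2) *: u1.1^R <->
  'X^k1 *: w2.1^R = 'X^(w2.2 + k2) *: w1.1^R.
Proof.
move=> hu1 hu2 w1 w2; have h1 := lform_homog M 1; have h2 := lform_homog M 2.
have hg : lf 1 * lf 2 \is 2.-homog by exact: (dhomogM h1 h2).
have gX : restr M (lf 1 * lf 2) = 'X by rewrite rmorphM restr_lform1 // restr_lform2 // mul1r.
have hw1 : is_sec Q 1 w1 := siso_sec phiS (ltn0Sn _) h1 hu1.
have hw2 : is_sec Q 1 w2 := siso_sec phiS (ltn0Sn _) h2 hu2.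
pose U1 := sec_res (lf 2) u1; pose U2 := sec_res (lf 1) u2.
have hU1 : is_sec P 2 U1 := is_sec_res Psat h2 hu1.
have hU2 : is_sec P 2 U2 := is_sec_res Psat h1 hu2.
(* The transition function [(lf 1 / lf 2)^(k1 - k2)] of the twist, written over
   [(lf 1 * lf 2)^(k1 + k2)] to keep exponents nonnegative; [phi] is linear over it. *)
pose s := (lf 1 ^+ k1.*2 * lf 2 ^+ k2.*2, (k1 + k2)%N).
have hs : s.1 \is (s.2 * 2)%N.-homog.
  have -> : (s.2 * 2 = 1 * k1.*2 + 1 * k2.*2)%N by rewrite /s /=; lia.
  by apply: dhomogM; apply: dhomogMn.
have sX : restr M s.1 = 'X^(k2.*2).
  by rewrite rmorphM !rmorphXn restr_lform1 // restr_lform2 // expr1n mul1r.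
have hsU1 := is_sec_scale Psat hs hU1.
pose A := phi (lf 1 * lf 2) (sec_scale s U1).
pose B := phi (lf 1 * lf 2) U1; pose C := phi (lf 1 * lf 2) U2.
have hA : is_sec Q 2 A := siso_sec phiS (ltn0Sn _) hg hsU1.
have hB : is_sec Q 2 B := siso_sec phiS (ltn0Sn _) hg hU1.
have hC : is_sec Q 2 C := siso_sec phiS (ltn0Sn _) hg hU2.
have := siso_scale phiS (ltn0Sn _) hg hs hU1.
rewrite (sec_eqX Qsat hg gX hA (is_sec_scale Qsat hs hB)) /=.
rewrite map_mxZ sX scalerA -exprD => eA.
have := siso_res phiS (ltn0Sn _) h1 h2 hu1.
rewrite (sec_eqX Qsat hg gX hB (is_sec_res Qsat h2 hw1)) /=.
rewrite map_mxZ rmorphXn restr_lform2 // scalerA -exprD => eB.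
have := siso_res phiS (ltn0Sn _) h2 h1 hu2.
rewrite [lf 2 * lf 1]mulrC (sec_eqX Qsat hg gX hC (is_sec_res Qsat h1 hw2)) /=.
rewrite map_mxZ rmorphXn restr_lform1 // expr1n scale1r => eC.
rewrite -(scaleXn_glue eA eB eC) -(sec_eqX Qsat hg gX hA hC).
rewrite -(siso_inj phiS (ltn0Sn _) hg hsU1 hU2) (sec_eqX Psat hg gX hsU1 hU2) /=.
rewrite !map_mxZ rmorphM !rmorphXn restr_lform1 // restr_lform2 //.
rewrite !expr1n mul1r scale1r !scalerA -!exprD.
split=> e.
  by rewrite -[(k1 + k2 + _)%N]addnA (scaleXn_shift _ e); congr ('X^_ *: _); lia.
apply: (@scaleXn_unshift _ _ (k2 + u1.2)); rewrite addnA -e; congr ('X^_ *: _).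
by rewrite -addnn !addnA.
Qed.

Lemma glob_push k1 k2 x : glob P k1 k2 x -> exists2 y, glob Q k1 k2 y & glob_rel x y.
Proof.
move=> [u1 [u2 [hu1 hu2 <-]]] /(glue_phi _ _ hu1 hu2) e.
exists (phi (lf 1) u1).1^R; last by exists u1.
exists (phi (lf 1) u1), (phi (lf 2) u2); split=> //.
  exact: (siso_sec phiS (ltn0Sn _) (lform_homog M 1) hu1).
exact: (siso_sec phiS (ltn0Sn _) (lform_homog M 2) hu2).
Qed.

Lemma glob_pull k1 k2 y : glob Q k1 k2 y -> exists2 x, glob P k1 k2 x & glob_rel x y.
Proof.
move=> [w1 [w2 [hw1 hw2 <- e]]]; have h1 := lform_homog M 1; have h2 := lform_homog M 2.
have [u1 hu1] := siso_surj phiS (ltn0Sn _) h1 hw1.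
rewrite (sec_eq1 Qsat (siso_sec phiS (ltn0Sn _) h1 hu1) hw1) => e1.
have [u2 hu2] := siso_surj phiS (ltn0Sn _) h2 hw2.
rewrite (sec_eqX Qsat h2 (restr_lform2 Mu) (siso_sec phiS (ltn0Sn _) h2 hu2) hw2) => e2.
exists u1.1^R; last by exists u1.
exists u1, u2; split=> //; apply/(glue_phi _ _ hu1 hu2); rewrite e1.
apply: (@scaleXn_unshift _ _ w2.2).
rewrite [(k1 + _)%N]addnC (scaleXn_shift _ e2) [X in 'X^X *: w2.1^R]addnC.
rewrite (scaleXn_shift _ e); congr ('X^_ *: _).
by rewrite addnC addnA; exact: addnAC.
Qed.

End GlobalSections.

(** * From a basis with degree bounds to a sheaf isomorphism *)

Section IsoFromBasis.
Variables (K : fieldType) (M : 'M[K]_3).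
Hypothesis Mu : M \in unitmx.
Local Notation S := {mpoly K[3]}.
Local Notation lf := (lform M).
Local Notation "p ^R" := (map_mx (restr M) p) (at level 2, format "p ^R").
Variables (n : nat) (P : gpieces 'rV[S]_n) (d1 d2 : int).
Variables (sigma1 sigma2 : 'rV[{poly K}]_n).
Hypothesis Psat : saturated M P.
Hypothesis P_uniq : forall i j m, m != 0 -> P i m -> P j m -> i = j.
Hypothesis P_decomp : forall k m, P k m ->
  exists a b, [/\ degz (k - d1) a, degz (k - d2) b & m^R = a *: sigma1 + b *: sigma2].
Hypothesis sigma_free : forall a b, a *: sigma1 + b *: sigma2 = 0 -> a = 0 /\ b = 0.
Variable k0 : nat.
Hypothesis P_lift : forall (k : nat) a b, (k0 <= k)%N ->
  degz (k%:Z - d1) a -> degz (k%:Z - d2) b ->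
  exists2 m, P k%:Z m & m^R = a *: sigma1 + b *: sigma2.

Definition sigma_comb (w : 'rV[{poly K}]_2) := w 0 0 *: sigma1 + w 0 1 *: sigma2.

Lemma sigma_combZ a w : sigma_comb (a *: w) = a *: sigma_comb w.
Proof. by rewrite /sigma_comb !mxE scalerDr !scalerA. Qed.

Lemma sigma_combD w w' : sigma_comb (w + w') = sigma_comb w + sigma_comb w'.
Proof. by rewrite /sigma_comb !mxE !scalerDl addrACA. Qed.

Lemma sigma_combN w : sigma_comb (- w) = - sigma_comb w.
Proof. by rewrite -scaleN1r sigma_combZ scaleN1r. Qed.

Lemma sigma_comb_eq0 w : sigma_comb w = 0 <-> w = 0.
Proof.
split=> [/sigma_free[w0 w1]|->]; last by rewrite /sigma_comb !mxE !scale0r addr0.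
apply/rowP => i; rewrite mxE; have : (i == 0) || (i == 1) by case: i => -[|[]].
by case/orP => /eqP ->.
Qed.

(** One [w] must serve all [k], so that coordinates are a function of [m] alone; a nonzero [m] lies
    in a single degree. *)
Lemma exists_coordinates m : exists w : 'rV[S]_2, forall k, P k m ->
  twist2 d1 d2 k w /\ sigma_comb w^R = m^R.
Proof.
have [->|m0] := eqVneq m 0.
  exists 0 => k _; split; first by split; rewrite mxE; exact: homogz0.
  by rewrite !map_mx0; apply/sigma_comb_eq0.
have [[k hm]|hm] := EM (exists k, P k m); last first.
  by exists 0 => k hk; case: hm; exists k.
have [a [b [ha hb mE]]] := P_decomp hm.
exists (\row_(i < 2) if i == 0 then homogenz M (k - d1) a else homogenz M (k - d2) b).
move=> j /(P_uniq m0 hm) <-; split.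
  by split; rewrite mxE /=; exact: homogenz_homogz.
by rewrite /sigma_comb !mxE /= !restr_homogenz.
Qed.

Definition coordinates m := projT1 (cid (exists_coordinates m)).

Lemma coordinates_twist2 k m : P k m -> twist2 d1 d2 k (coordinates m).
Proof. by move=> hm; case: (projT2 (cid (exists_coordinates m)) k hm). Qed.

Lemma coordinatesK k m : P k m -> sigma_comb (coordinates m)^R = m^R.
Proof. by move=> hm; case: (projT2 (cid (exists_coordinates m)) k hm). Qed.

Lemma isomorphic_twist2 : isomorphic_on_line P (twist2 d1 d2 : gpieces 'rV[S]_2) (lf 0).
Proof.
have Qsat := @twist2_saturated _ _ Mu d1 d2.
pose phi (_ : S) (u : 'rV[S]_n * nat) := (coordinates u.1, u.2).
have phi_sec e g u : is_sec P e u -> is_sec (twist2 d1 d2 : gpieces 'rV[S]_2) e (phi g u).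
  exact: coordinates_twist2.
exists phi; split.
- by move=> e g u _ _; exact: phi_sec.
- move=> e g u v e0 hg hu hv.
  rewrite (sec_eqE Mu Psat hg hu hv) (sec_eqE Mu Qsat hg) //; try exact: phi_sec.
  rewrite -sigma_comb_eq0 sigma_combZ sigma_combD sigma_combN !sigma_combZ /=.
  by rewrite (coordinatesK hu) (coordinatesK hv).
- move=> e g w e0 hg hw.
  have hgn k : degz (k * e)%N%:Z (restr M g ^+ k).
    by rewrite -rmorphXn; apply: restr_degz => //=; rewrite mulnC; exact: dhomogMn.
  have degw (i : 'I_2) di : homogz ((w.2 * e)%N%:Z - di) (w.1 0 i) ->
      degz (((k0 + w.2) * e)%N%:Z - di) (restr M g ^+ k0 * w.1^R 0 i).
    move=> h; rewrite mulnDl PoszD -addrA; apply: degzM => //.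
    by rewrite mxE; exact: restr_degz.
  have [h0 h1] := hw.
  (* Expanding the fraction by [g^k0] brings its numerator to degree at least [k0], because [e > 0];
     there [P_lift] applies. *)
  have kk : (k0 <= (k0 + w.2) * e)%N by rewrite (leq_trans (leq_addr w.2 k0)) // leq_pmulr.
  have [m hm mE] := P_lift kk (degw 0 d1 h0) (degw 1 d2 h1).
  exists (m, (k0 + w.2)%N) => //.
  rewrite (sec_eqE Mu Qsat hg (phi_sec e g (m, (k0 + w.2)%N) hm) hw).
  apply/sigma_comb_eq0; rewrite sigma_combZ sigma_combD sigma_combN !sigma_combZ /=.
  rewrite (coordinatesK hm) mE /sigma_comb -!scalerA -scalerDr scalerA addnC exprD.
  by rewrite subrr scaler0.
- move=> e g u v e0 hg hu hv; have huv := is_sec_add Psat hg hu hv.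
  have huv' := is_sec_add Qsat hg (phi_sec e g u hu) (phi_sec e g v hv).
  rewrite (sec_eqE Mu Qsat hg (phi_sec e g _ huv) huv').
  apply/sigma_comb_eq0; rewrite sigma_combZ sigma_combD sigma_combN !sigma_combZ /=.
  rewrite (coordinatesK huv) !map_mxD !map_mxZ sigma_combD !sigma_combZ.
  by rewrite (coordinatesK hu) (coordinatesK hv) subrr scaler0.
- move=> e g s u e0 hg hs hu; have hsu := is_sec_scale Psat hs hu.
  have hsu' := is_sec_scale Qsat hs (phi_sec e g u hu).
  rewrite (sec_eqE Mu Qsat hg (phi_sec e g _ hsu) hsu').
  apply/sigma_comb_eq0; rewrite sigma_combZ sigma_combD sigma_combN !sigma_combZ /=.
  by rewrite (coordinatesK hsu) !map_mxZ sigma_combZ (coordinatesK hu) subrr scaler0.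
move=> e g e' h u e0 hg hh hu; have hru := is_sec_res Psat hh hu.
have hru' := is_sec_res Qsat hh (phi_sec e g u hu).
rewrite (sec_eqE Mu Qsat (dhomogM hg hh) (phi_sec _ (g * h) _ hru) hru').
apply/sigma_comb_eq0; rewrite sigma_combZ sigma_combD sigma_combN !sigma_combZ /=.
by rewrite (coordinatesK hru) !map_mxZ sigma_combZ (coordinatesK hu) subrr scaler0.
Qed.

End IsoFromBasis.

(** * Splitting along a line avoiding Z *)

Section HomogeneousComponents.
Variables (n : nat) (K : fieldType).
Implicit Types p q : {mpoly K[n]}.

Lemma pihomogM_dhomog j e p q : q \is e.-homog ->
  pihomog mdeg (j + e) (p * q) = pihomog mdeg j p * q.
Proof.
move=> hq; rewrite -!coef_grading_mor rmorphM (grading_mor_dhomog hq).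
rewrite -scalerAr coefZ coefMXn addnK ltnNge leq_addl /=; exact: mulrC.
Qed.

Lemma mderiv_dhomog d i p : p \is d.+1.-homog -> p^`M(i) \is d.-homog.
Proof.
move=> /dhomogP hp; apply/dhomogP => x; rewrite mcoeff_msupp mcoeff_deriv => h.
have : (x + U_(i))%MM \in msupp p.
  by rewrite mcoeff_msupp; apply: contraNneq h => ->; rewrite mul0rn.
by move/hp => /= /eqP; rewrite mdegD mdeg1 addn1 eqSS => /eqP.
Qed.

End HomogeneousComponents.

(** The Cech form of [H^1(O(k - N)) = 0]: for [N <= k + 1] the exponents [0..k] and [N..N+k] cover
    [0..N+k] without a gap. *)
Lemma degz_split (R : comNzRingType) (N : nat) k (u : {poly R}) :
  N%:Z <= k + 1 -> degz (N%:Z + k) u ->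
  exists c0 c1, [/\ degz k c0, degz k c1 & u = 'X^N * c0 + c1].
Proof.
move=> Nk hu; exists (drop_poly N u), (take_poly N u); split.
- by move=> j jk; rewrite coef_drop_poly hu // PoszD; lia.
- by move=> j jk; rewrite coef_take_poly; case: ltnP => // jN; lia.
- by rewrite addrC mulrC poly_take_drop.
Qed.

(** Otherwise [lform M 0] could be divided out, leaving a nonzero syzygy of degree [r - 1]; for
    [r = 0] this is degree -1, where everything is 0. *)
Lemma restr_syzygy_neq0 (K : fieldType) (f : {mpoly K[3]}) r rho (M : 'M[K]_3) :
  is_mdr f r -> AR f r%:Z rho -> rho != 0 -> M \in unitmx ->
  map_mx (restr M) rho != 0.
Proof.
move=> hr hrho rho0 Mu; apply/eqP => s0.
have [w hw rE] := sat_div (AR_saturated Mu f) hrho s0.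
case/eqP: rho0; rewrite rE; suff -> : w = 0 by rewrite scaler0.
case: r hr hw {hrho} => [|r'] [_ hmin] hw; last first.
  by apply: (hmin r' (ltnSn _)); move: hw; rewrite -addn1 PoszD addrK.
by case: hw => hw _; apply/rowP => i; rewrite mxE; apply: (hw i).
Qed.

Section SplittingData.
Variables (K : numClosedFieldType) (r s : nat) (f : {mpoly K[3]}).
Variable rho1 : 'rV[{mpoly K[3]}]_3.
Local Notation d := (r + s).+1.
Hypotheses (hf : reduced_curve d f) (hr : is_mdr f r).
Hypotheses (hrho1 : AR f r%:Z rho1) (rho1_neq0 : rho1 != 0).
Variable M : 'M[K]_3.
Hypothesis Mu : M \in unitmx.
Local Notation S := {mpoly K[3]}.
Local Notation lf := (lform M).
Local Notation "p ^R" := (map_mx (restr M) p) (at level 2, format "p ^R").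
Local Notation sigma1 := (rho1^R).
Implicit Types (b h p : S) (m w : 'rV[S]_3).

(** [idealB] ranges over all syzygies, while sections need homogeneous ones. Components of a syzygy
    are syzygies, the partials being homogeneous of degree [r + s], and [v] lowers degrees by [s]
    because [k + r + 1 - d = k - s]. *)
Lemma component m b n : syzygy f m -> Delta rho1 m = b * f ->
  exists m', AR f (n + s)%N m' /\ Delta rho1 m' = pihomog mdeg n b * f.
Proof.
move=> sm mE; have [h1 s1] := hrho1; have fh := f_homog hf.
exists (\row_i pihomog mdeg (n + s) (m 0 i)); split.
  split=> [i|]; first by rewrite mxE; exact: pihomogP.
  transitivity (pihomog mdeg (n + s + (r + s)) (\sum_(i < 3) m 0 i * f^`M(i))).
    rewrite raddf_sum; apply: eq_bigr => i _.
    by rewrite /= mxE pihomogM_dhomog // mderiv_dhomog.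
  by rewrite sm raddf0.
rewrite -(pihomogM_dhomog n b fh) -mE !DeltaE !mxE.
have -> : (n + (r + s).+1 = n + s + r + 1)%N by lia.
have hX (i j k : 'I_3) : 'X_i * (rho1 0 j * pihomog mdeg (n + s) (m 0 k)) =
    pihomog mdeg (n + s + r + 1) ('X_i * (rho1 0 j * m 0 k)).
  have hx : ('X_i : S) \is 1.-homog by rewrite dhomogX /= mdeg1.
  have -> : 'X_i * (rho1 0 j * m 0 k) = m 0 k * rho1 0 j * 'X_i by ring.
  rewrite (pihomogM_dhomog _ _ hx) (pihomogM_dhomog _ _ (h1 j : _ \is r.-homog)); ring.
by rewrite !mulrBr !(raddfB, raddfD) /= !hX.
Qed.

Hypothesis havoid : forall p : 'rV[K]_3, on_line (row 0 M) p -> ~ suppZ f rho1 p.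

Lemma avoid_point (p : 'rV[K]_3) : p != 0 -> on_line (row 0 M) p ->
  exists n m b, [/\ AR f (n + s)%N m, Delta rho1 m = b * f, b \is n.-homog
    & b.@[fun i => p 0 i] != 0].
Proof.
move=> p0 /havoid hp.
have [b [[m sm mE] bp]] : exists b, idealB f rho1 b /\ b.@[fun i => p 0 i] != 0.
  apply: contrapT => h; apply: hp; split=> // b hb.
  by apply/eqP/negPn/negP => bp; apply: h; exists b.
have [n hn] : exists n, (pihomog mdeg n b).@[fun i => p 0 i] != 0.
  apply: contrapT => /forallNP h; case/eqP: bp.
  rewrite (pihomog_partitionE (leqnn (mmeasure mdeg b))) rmorph_sum big1 // => i _.
  by apply/eqP/negPn/negP; exact: h.
have [m' [hm' m'E]] := component n sm mE.
by exists n, m', (pihomog mdeg n b); split=> //; exact: pihomogP.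
Qed.

(** The image of the ideal B(C, rho1) in the coordinate ring of an affine chart
    of the line. *)
Definition restrB (u : {poly K}) := exists n m b,
  [/\ AR f (n + s)%N m, Delta rho1 m = b * f, b \is n.-homog & restr M b = u].

Lemma restrB_mul v u : restrB u -> restrB (v * u).
Proof.
move=> [n [m [b [hm mE hb <-]]]]; pose h := homogen M (size v) v.
exists (size v + n)%N, (h *: m), (h * b); split.
- by rewrite -addnA PoszD; apply: AR_scale hm; exact: homogen_homog.
- by rewrite DeltaZ mE mulrA.
- by apply: dhomogM => //; exact: homogen_homog.
- by rewrite rmorphM restr_homogen.
Qed.

Lemma restrB_add u v : restrB u -> restrB v -> restrB (u + v).
Proof.
move=> [n [m [b [hm mE hb <-]]]] [n' [m' [b' [hm' mE' hb' <-]]]].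
have l1 (j : nat) : lf 1 ^+ j \is j.-homog.
  by rewrite -[X in X.-homog]mul1n; apply: dhomogMn; exact: lform_homog.
exists (n' + n)%N, (lf 1 ^+ n' *: m + lf 1 ^+ n *: m'), (lf 1 ^+ n' * b + lf 1 ^+ n * b').
split.
- apply: AR_add; first by rewrite -addnA PoszD; apply: AR_scale hm => /=.
  by rewrite [(n' + n)%N]addnC -addnA PoszD; apply: AR_scale hm' => /=.
- by rewrite Delta_linear2 mE mE'; ring.
- by apply: dhomogD; [|rewrite addnC]; apply: dhomogM.
- by rewrite rmorphD !rmorphM !rmorphXn restr_lform1 // !expr1n !mul1r.
Qed.

(** [restrB] is an ideal of [K[t]], generated by a nonzero element of least size. A root of the
    generator would be a point of the line where all of [B(C, rho1)] vanishes; as [K] is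
    algebraically closed, the generator is a constant. *)
Lemma restrB_1 : restrB 1.
Proof.
have pointP (t : K) : exists2 u, restrB u & u.[t] != 0.
  pose p : 'rV[K]_3 := \row_i (invmx M i 1 + invmx M i 2 * t).
  have evalE (q : S) : q.@[fun i => p 0 i] = (restr M q).[t].
    by rewrite horner_restr; apply: meval_eq => i; rewrite mxE.
  have [||n [m [b [hm mE hb bp]]]] := @avoid_point p.
  - apply/eqP => p0; have := evalE (lf 1); rewrite restr_lform1 // hornerC /lform /line_eq.
    rewrite raddf_sum /= big1 => [/esym/eqP|i _]; first by rewrite oner_eq0.
    by rewrite mevalZ mevalXU p0 !mxE mulr0.
  - by rewrite /on_line evalE -/(lf 0) restr_lform0 // horner0.
  - by exists (restr M b); [exists n, m, b | rewrite -evalE].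
have exu : exists n, `[< exists u : {poly K}, [/\ u != 0, size u = n & restrB u] >].
  have [u Bu u0] := pointP 0; exists (size u); apply/asboolP; exists u; split=> //.
  by apply: contraNneq u0 => ->; rewrite horner0.
case: (ex_minnP exu) => n /asboolP[u [u0 sun Bu]] nmin.
have udvd v : restrB v -> u %| v.
  move=> Bv; apply/negPn/negP; rewrite /dvdp => r0.
  have : (n <= size (v %% u)%R)%N.
    apply: nmin; apply/asboolP; exists (v %% u); split=> //.
    rewrite -[v %% u](addKr (v %/ u * u)) -divp_eq addrC -mulNr.
    by apply: restrB_add => //; exact: restrB_mul.
  by rewrite -sun leqNgt ltn_modp u0.
have [su|/closed_rootP[t ut]] := eqVneq (size u) 1%N.
  have /eqP/size_poly1P[c c0 uE] := su.
  rewrite -[1](_ : c^-1%:P * u = 1); first exact: restrB_mul.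
  by rewrite uE -polyCM mulVf.
have [v Bv] := pointP t; case/dvdpP: (udvd _ Bv) => q ->.
by rewrite hornerM (eqP ut) mulr0 eqxx.
Qed.

(** The point of the line outside the chart avoids [Z] too; by [lead_restr], not vanishing there
    means restricting with full degree [n]. *)
Lemma restrB_infinity : exists n m b, [/\ AR f (n + s)%N m, Delta rho1 m = b * f,
  b \is n.-homog & size (restr M b) = n.+1].
Proof.
pose p : 'rV[K]_3 := \row_i invmx M i 2.
have evalE (q : S) : q.@[fun i => p 0 i] = q.@[fun i => invmx M i 2].
  by apply: meval_eq => i; rewrite mxE.
have [||n [m [b [hm mE hb]]]] := @avoid_point p.
- apply/eqP => p0; have := meval_lform Mu 2 2; rewrite -evalE /lform /line_eq.
  rewrite raddf_sum /= big1 => [/esym/eqP|i _]; first by rewrite ?eqxx oner_eq0.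
  by rewrite mevalZ mevalXU p0 !mxE mulr0.
- by rewrite /on_line evalE -/(lf 0) meval_lform.
rewrite evalE -(lead_restr Mu hb) => bp; exists n, m, b; split=> //.
apply/eqP; rewrite eqn_leq; have [-> _] := homogen_restr Mu hb.
by rewrite ltnNge; apply: contra bp => /leq_sizeP ->.
Qed.

Lemma homogz_val k m b : AR f k m -> Delta rho1 m = b * f -> homogz (k - s%:Z) b.
Proof.
move=> hm mE; have := homogz_Delta hf hrho1 hm mE.
by have -> : k + r%:Z + 1 - (r + s).+1%:Z = k - s%:Z by rewrite -addn1 !PoszD; ring.
Qed.

(** b' m - b m' is killed by v, hence a multiple of rho1. *)
Lemma restr_exchange (n : nat) k m b m' b' : AR f k m -> Delta rho1 m = b * f ->
  AR f (n + s)%N m' -> Delta rho1 m' = b' * f -> b' \is n.-homog ->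
  exists2 a, degz (n%:Z + (k - r%:Z)) a
    & restr M b' *: m^R = restr M b *: m'^R + a *: sigma1.
Proof.
move=> hm mE hm' mE' hb'; have hb := homogz_val hm mE.
have hAR : AR f (n%:Z + k) (b' *: m + (- b) *: m').
  apply: AR_add; first exact: AR_scale.
  have -> : n%:Z + k = (k - s%:Z) + (n + s)%N%:Z by rewrite PoszD; ring.
  by apply: AR_scale hm'; exact: homogzN.
have D0 : Delta rho1 (b' *: m + (- b) *: m') = 0.
  by rewrite Delta_linear2 mE mE'; ring.
have [h hE] := Delta_eq0 hf hr hrho1 rho1_neq0 (snd hAR) D0.
have hh : homogz (n%:Z + k - r%:Z) h.
  by apply: (AR_multiple hrho1 rho1_neq0 (f := f)); rewrite -hE.
exists (restr M h); first by rewrite addrA; exact: restr_degz.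
have := congr1 (map_mx (restr M)) hE; rewrite map_mxD !map_mxZ rmorphN scaleNr => <-.
by rewrite addrC subrK.
Qed.

(** Euclidean division of ['X^N] by [c], which has degree exactly [n1]. For [N = n0 + n1] the
    quotient has degree [n0] and the remainder degree below [n1], so that [x *: m1] and [y *: m0]
    both have degree [N + s]. *)
Lemma splitting_pair : exists N m0 b0 m1 b1,
  [/\ AR f (N + s)%N m0, Delta rho1 m0 = b0 * f, b0 \is N.-homog & restr M b0 = 1] /\
  [/\ AR f (N + s)%N m1, Delta rho1 m1 = b1 * f, b1 \is N.-homog & restr M b1 = 'X^N].
Proof.
have [n0 [m0 [b0 [h0 e0 hb0 r0]]]] := restrB_1.
have [n1 [m1 [b1 [h1 e1 hb1 s1]]]] := restrB_infinity.
pose N := (n0 + n1)%N; pose c := restr M b1.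
have c0 : c != 0 by rewrite -size_poly_eq0 /c s1.
pose x := homogen M n0 ('X^N %/ c); pose y := homogen M n1 ('X^N %% c).
have hx : x \is n0.-homog := homogen_homog _ _ _.
have hy : y \is n1.-homog := homogen_homog _ _ _.
have l1 : lf 1 ^+ n1 \is n1.-homog.
  by rewrite -[X in X.-homog]mul1n; apply: dhomogMn; exact: lform_homog.
exists N, (lf 1 ^+ n1 *: m0), (lf 1 ^+ n1 * b0), (x *: m1 + y *: m0), (x * b1 + y * b0).
split; split.
- have -> : (N + s = n1 + (n0 + s))%N by rewrite /N; lia.
  by rewrite PoszD; apply: AR_scale h0.
- by rewrite DeltaZ e0 mulrA.
- by rewrite /N addnC; exact: dhomogM.
- by rewrite rmorphM rmorphXn restr_lform1 // expr1n mul1r.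
- apply: AR_add; first by rewrite /N -addnA PoszD; apply: AR_scale h1.
  have -> : (N + s = n1 + (n0 + s))%N by rewrite /N; lia.
  by rewrite PoszD; apply: AR_scale h0.
- by rewrite Delta_linear2 e0 e1; ring.
- by apply: dhomogD; [|rewrite /N addnC]; apply: dhomogM.
have sx : (size ('X^N %/ c)%R <= n0.+1)%N.
  by rewrite size_divp // size_polyXn /c s1 /N; lia.
have sy : (size ('X^N %% c)%R <= n1.+1)%N.
  by rewrite ltnW // -s1 ltn_modp.
by rewrite rmorphD !rmorphM r0 mulr1 !restr_homogen // -divp_eq.
Qed.

Hypothesis rs : (r <= s.+1)%N.

Lemma splitting_section : exists N m0 m1,
  [/\ AR f (N + s)%N m0, AR f (N + s)%N m1 & m1^R = 'X^N *: m0^R] /\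
  exists b0 b1, [/\ Delta rho1 m0 = b0 * f, b0 \is N.-homog & restr M b0 = 1] /\
  [/\ Delta rho1 m1 = b1 * f, b1 \is N.-homog & restr M b1 = 'X^N].
Proof.
have [N [m0 [b0 [m1 [b1 [[h0 e0 hb0 r0] [h1 e1 hb1 r1]]]]]]] := splitting_pair.
have [c hc cE] := restr_exchange h1 e1 h0 e0 hb0.
rewrite r0 r1 scale1r in cE.
(* Here [2 r <= d] enters: for [k = N + s - r] the condition [N <= k + 1] is [rs]. *)
have [||c0 [c1 [hc0 hc1 cE']]] := @degz_split _ N (N%:Z + s%:Z - r%:Z) c.
- by lia.
- by move: hc; rewrite PoszD.
pose k := N%:Z + s%:Z - r%:Z.
have hrho (u : {poly K}) : AR f (N + s)%N (homogenz M k u *: rho1).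
  have -> : (N + s)%N%:Z = k + r%:Z by rewrite /k PoszD; ring.
  by apply: AR_scale hrho1; exact: homogenz_homogz.
have Drho u m b : Delta rho1 m = b * f -> Delta rho1 (homogenz M k u *: rho1 + m) = b * f.
  by rewrite Delta_linear Delta_self mulr0 add0r.
exists N, (homogenz M k c0 *: rho1 + m0), (homogenz M k (- c1) *: rho1 + m1).
split; last by exists b0, b1; split; split=> //; exact: Drho.
split; try exact: AR_add.
rewrite !map_mxD !map_mxZ !restr_homogenz //; last exact: degzN.
rewrite cE cE' scalerDr scalerA scalerDl scaleNr.
by rewrite addrC -!addrA subrr addr0 addrC.
Qed.

Lemma splitting_basis : exists sigma2 (k0 : nat),
  [/\ forall k m, AR f k m -> exists a b : {poly K},
        [/\ degz (k - r%:Z) a, degz (k - s%:Z) b & m^R = a *: sigma1 + b *: sigma2],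
      forall a b : {poly K}, a *: sigma1 + b *: sigma2 = 0 -> a = 0 /\ b = 0
    & forall (k : nat) (a b : {poly K}), (k0 <= k)%N ->
        degz (k%:Z - r%:Z) a -> degz (k%:Z - s%:Z) b ->
        exists2 m, AR f k%:Z m & m^R = a *: sigma1 + b *: sigma2].
Proof.
have [N [m0 [m1 [[h0 h1 m1E] [b0 [b1 [[e0 hb0 r0] [e1 hb1 r1]]]]]]]] := splitting_section.
have s10 := restr_syzygy_neq0 hr hrho1 rho1_neq0 Mu.
(* Lifting will split a polynomial of degree [k - s] at ['X^N], which needs [N <= (k - s - N) + 1];
   [k >= s + 2 N] ensures it. *)
exists m0^R, (s + N.*2)%N; split.
- move=> k m hm; have [b mE] := dvdr_Delta hf hrho1 (snd hm).
  have [a ha aE] := restr_exchange hm mE h0 e0 hb0.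
  have [a' ha' aE'] := restr_exchange hm mE h1 e1 hb1.
  rewrite r0 scale1r in aE.
  exists a, (restr M b); split; last 1 first.
  + by rewrite aE addrC.
  (* Comparison with [m0] bounds the degree of [a] only by [N + k - r]. Comparison with [m1], which
     restricts to ['X^N] times [m0], gives the same bound for ['X^N * a], and the excess [N]
     disappears. *)
  + apply/(degzXn N); suff <- : a' = 'X^N * a by [].
    apply/eqP; rewrite -subr_eq0; have : (a' - 'X^N * a) *: sigma1 = 0.
      apply/eqP; rewrite scalerBl -scalerA subr_eq0; apply/eqP.
      apply: (addrI (restr M b *: m1^R)); rewrite -aE' r1 m1E aE scalerDr.
      by rewrite !scalerA [restr M b * _]mulrC.
    by move/eqP; rewrite scalemx_eq0 (negPf s10) orbF.
  + by apply: restr_degz => //; exact: homogz_val hm mE.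
(* The relation is lifted to a homogeneous element of [AR(f)], which is divisible by [lf 0];
   applying [v] and restricting leaves [b = 0], since [b0] restricts to 1. *)
- move=> a b ab0; pose n := maxn (size a) (size b).
  have sa : (size a <= (n + N + s).+1)%N by rewrite /n; lia.
  have sb : (size b <= (n + r).+1)%N by rewrite /n; lia.
  pose m := homogen M (n + N + s) a *: rho1 + homogen M (n + r) b *: m0.
  have hm : AR f (n + N + s + r)%N m.
    apply: AR_add; first by rewrite PoszD; apply: AR_scale hrho1; exact: homogen_homog.
    have -> : (n + N + s + r = (n + r) + (N + s))%N by lia.
    by rewrite PoszD; apply: AR_scale h0; exact: homogen_homog.
  have mR : m^R = 0 by rewrite map_mxD !map_mxZ !restr_homogen.
  have [w hw mE] := sat_div (AR_saturated Mu f) hm mR.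
  have [b' wE] := dvdr_Delta hf hrho1 (snd hw).
  have b0E : homogen M (n + r) b * b0 = lf 0 * b'.
    apply: (mulIf (f_neq0 hf)); rewrite -!mulrA -e0 -wE.
    transitivity (Delta rho1 m); first by rewrite Delta_linear Delta_self mulr0 add0r DeltaZ.
    by rewrite mE DeltaZ.
  have bE : b = 0.
    have := congr1 (restr M) b0E.
    by rewrite !rmorphM r0 mulr1 restr_homogen // restr_lform0 // mul0r.
  split=> //; move: ab0; rewrite bE scale0r addr0 => /eqP.
  by rewrite scalemx_eq0 (negPf s10) orbF => /eqP.
- move=> k a b kN ha hb.
  (* [m0] has degree [N + s] rather than [s], so a multiplier of degree [k - s] would overshoot [k]
     by [N]; the part ['X^N * c0] of [b] is carried by [m1], whose restriction already contains
     ['X^N]. *)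
  have [||c0 [c1 [hc0 hc1 bE]]] := @degz_split _ N (k%:Z - s%:Z - N%:Z) b.
  + by lia.
  + by have -> : N%:Z + (k%:Z - s%:Z - N%:Z) = k%:Z - s%:Z by ring.
  pose j := k%:Z - s%:Z - N%:Z.
  exists (homogenz M (k%:Z - r%:Z) a *: rho1
    + (homogenz M j c1 *: m0 + homogenz M j c0 *: m1)).
    apply: AR_add.
      have -> : k%:Z = (k%:Z - r%:Z) + r%:Z by ring.
      by apply: AR_scale hrho1; rewrite addrK; exact: homogenz_homogz.
    have -> : k%:Z = j + (N + s)%N%:Z by rewrite /j PoszD; ring.
    by apply: AR_add; apply: AR_scale => //; exact: homogenz_homogz.
  rewrite !map_mxD !map_mxZ !restr_homogenz // m1E bE scalerA -scalerDl.
  by rewrite addrC [c1 + _]addrC [c0 * _]mulrC addrC.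
Qed.

Lemma splitting_on_line :
  isomorphic_on_line (AR f) (twist2 r%:Z s%:Z : gpieces 'rV[S]_2) (lf 0).
Proof.
have [sigma2 [k0 [decomp free lift]]] := splitting_basis.
apply: (isomorphic_twist2 Mu (AR_saturated Mu f) _ decomp free lift).
by move=> i j m m0 hi hj; exact: AR_uniq m0 hi hj.
Qed.

End SplittingData.

(** * Comparison of splitting types *)

Section Nonvanishing.
Variable K : numFieldType.

Lemma exists_nonroot (p : {poly K}) : p != 0 -> exists t, p.[t] != 0.
Proof.
move=> p0; apply: contrapT => /forallNP h.
have := @max_poly_roots _ p [seq i%:R | i <- iota 0 (size p)] p0.
rewrite size_map size_iota ltnn => /(_ _ _)/negP; case.
- by apply/allP => x _; apply/negPn/negP/h.
- by rewrite map_inj_uniq ?iota_uniq // => i j /eqP; rewrite eqr_nat => /eqP.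
by [].
Qed.

Lemma meval_muni n (p : {mpoly K[n.+1]}) (v : 'I_n -> K) t :
  p.@[fun i => oapp v t (unlift ord_max i)] = (map_poly (meval v) (muni p)).[t].
Proof.
move: p; apply: (eq_mpoly_rmorph (phi := meval (fun i => oapp v t (unlift ord_max i)))
  (psi := (horner_eval t \o map_poly (meval v) \o @muni n K)%FUN)) => [c|i].
  change (c%:MP.@[fun i => oapp v t (unlift ord_max i)]
    = (map_poly (meval v) (muni c%:MP)).[t]).
  by rewrite mevalC muniC map_polyC /= hornerC mevalC.
change (('X_i).@[fun i => oapp v t (unlift ord_max i)]
  = (map_poly (meval v) (muni 'X_i)).[t]).
rewrite mevalXU; case: unliftP => [j ->|->] /=.
  have -> : lift ord_max j = widen_ord (leqnSn n) j.
    by apply/val_inj; rewrite /= /bump leqNgt ltn_ord.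
  by rewrite muniX_widen map_polyC /= hornerC mevalXU.
by rewrite muniX_max map_polyX hornerX.
Qed.

Lemma exists_nonzero_meval n (p : {mpoly K[n]}) : p != 0 -> exists v, p.@[v] != 0.
Proof.
elim: n p => [|n IHn] p p0.
  exists (fun=> 0); rewrite (nvar0_mpolyC p) mevalC; apply: contraNneq p0 => p00.
  by rewrite (nvar0_mpolyC p) p00 mpolyC0.
have mp0 : muni p != 0.
  by apply: contraNneq p0 => mp; rewrite -(muniK p) mp rmorph0.
have [v hv] := IHn (lead_coef (muni p)) (etrans (congr1 negb (lead_coef_eq0 _)) mp0).
have [|t ht] := @exists_nonroot (map_poly (meval v) (muni p)).
  by rewrite -size_poly_eq0 size_map_poly_id0 ?size_poly_eq0.
by exists (fun i => oapp v t (unlift ord_max i)); rewrite meval_muni.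
Qed.

End Nonvanishing.

(** By Gaussian elimination, a nonzero row is a unit times the first row of the invertible
    [row_ebase a]. *)
Lemma row0_unitmx (K : fieldType) n (a : 'rV[K]_n.+1) : a != 0 ->
  exists2 M : 'M[K]_n.+1, M \in unitmx & row 0 M = a.
Proof.
move=> a0; pose c := col_ebase a 0 0.
have c0 : c != 0.
  have := col_ebase_unit a; rewrite unitmxE det_mx11 unitfE //.
exists (c *: row_ebase a).
  by rewrite unitmxE detZ unitrM unitrX -?unitmxE ?row_ebase_unit ?unitfE.
rewrite -[RHS](mulmx_ebase a) (rank_rV a) a0 (mx11_scalar (col_ebase a)) -mulmxA mul_scalar_mx.
rewrite -/c linearZ; congr (_ *: _); apply/rowP => j.
rewrite !mxE (bigD1 0) //= mxE eqxx mul1r.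
rewrite big1 ?addr0 // => i i0; rewrite mxE (_ : _ && _ = false) ?mul0r //.
by rewrite andbC eq_sym; apply: negbTE.
Qed.

Section UniqueSplitting.
Variables (K : fieldType) (M : 'M[K]_3).
Hypothesis Mu : M \in unitmx.
Local Notation S := {mpoly K[3]}.
Local Notation lf := (lform M).
Local Notation "p ^R" := (map_mx (restr M) p) (at level 2, format "p ^R").

Lemma glob_AR f (k : nat) m : AR f k m -> glob M (AR f) k 0 m^R.
Proof. by move=> hm; exists (m, k), (m, k); rewrite /is_sec /= muln1 addn0. Qed.

(** The expression in the second chart bounds the degree: a global section of [O(n)] is a polynomial
    of degree at most [n]. *)
Lemma glob_twist2 d1 d2 k1 k2 y : glob M (twist2 d1 d2 : gpieces 'rV[S]_2) k1 k2 y ->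
  degz (k1%:Z - k2%:Z - d1) (y 0 0) /\ degz (k1%:Z - k2%:Z - d2) (y 0 1).
Proof.
move=> [u1 [u2 [_ [h0 h1] _ e]]].
have deg (i : 'I_2) di : homogz ((u2.2 * 1)%N%:Z - di) (u2.1 0 i) ->
    degz (k1%:Z - k2%:Z - di) (y 0 i).
  move=> /(restr_degz Mu) h; apply/(degzXn (u2.2 + k2)).
  move/rowP/(_ i): e; rewrite !mxE => <-.
  have -> : (u2.2 + k2)%N%:Z + (k1%:Z - k2%:Z - di) = k1%:Z + ((u2.2 * 1)%N%:Z - di).
    by rewrite muln1 PoszD; ring.
  exact/degzXn.
by split; exact: deg.
Qed.

Lemma glob_rel0 n m (P : gpieces 'rV[S]_n) (Q : gpieces 'rV[S]_m) phi :
  saturated M P -> saturated M Q -> sheaf_iso_on_line P Q (lf 0) phi -> P 0 0 ->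
  glob_rel M P phi 0 0.
Proof.
move=> Psat Qsat phiS P0; have h : glob_rel M P phi 0 (phi (lf 1) (0, 0%N)).1^R.
  by exists (0, 0%N); rewrite map_mx0.
by have := glob_relZ Mu Psat Qsat phiS 0 h; rewrite !scale0r.
Qed.

(** Twisted by [d1], the second sum has the global section [(1, 0)], while the first has two
    negative degrees and no nonzero section. *)
Lemma twist2_first_le f (r1 r2 d1 d2 : int) :
  isomorphic_on_line (AR f) (twist2 r1 r2 : gpieces 'rV[S]_2) (lf 0) ->
  isomorphic_on_line (AR f) (twist2 d1 d2 : gpieces 'rV[S]_2) (lf 0) ->
  d1 < r1 -> d1 < r2 -> False.
Proof.
move=> [phi phiS] [psi psiS] dr1 dr2.
have Asat := AR_saturated Mu f.
have Rsat := twist2_saturated Mu r1 r2; have Dsat := twist2_saturated Mu d1 d2.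
have [k1 [k2 dE]] : exists k1 k2 : nat, d1 = k1%:Z - k2%:Z.
  by case: (d1) => k; [exists k, 0%N; rewrite subr0 | exists 0%N, k.+1; rewrite sub0r NegzE].
pose y : 'rV[{poly K}]_2 := \row_i (i == 0)%:R.
have hy : glob M (twist2 d1 d2 : gpieces 'rV[S]_2) k1 k2 y.
  pose w j : 'rV[S]_2 := \row_i ((i == 0)%:R * lf j ^+ k2).
  have hw j : is_sec (twist2 d1 d2 : gpieces 'rV[S]_2) 1 (w j, k1).
    rewrite /is_sec /= muln1 dE; split; rewrite mxE /= ?mul0r ?mul1r; last exact: homogz0.
    rewrite opprB addrC subrK /= -[X in X.-homog]mul1n; apply: dhomogMn; exact: lform_homog.
  exists (w 1, k1), (w 2, k1); split=> //.
    by apply/rowP => i; rewrite !mxE rmorphM rmorphXn restr_lform1 // expr1n mulr1 rmorph_nat.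
  by apply/rowP => i; rewrite !mxE rmorphM rmorphXn restr_lform2 // rmorph_nat exprD; ring.
have [x hx xy] := glob_pull Mu Asat Dsat psiS hy.
have [z hz xz] := glob_push Mu Asat Rsat phiS hx.
have [z0 z1] := glob_twist2 hz.
have zE : z = 0.
  apply/rowP => i; rewrite mxE; have : (i == 0) || (i == 1) by case: i => -[|[]].
  by case/orP => /eqP ->; [apply: degz_lt0 z0 | apply: degz_lt0 z1]; rewrite -dE subr_lt0.
have rel0 := glob_rel0 Asat Rsat phiS (AR0 f 0).
have x0 : x = 0 by apply/(glob_rel_inj Mu Asat Rsat phiS xz rel0).
have rel0' := glob_rel0 Asat Dsat psiS (AR0 f 0).
have /rowP/(_ 0) : y = 0 by apply/(glob_rel_inj Mu Asat Dsat psiS xy rel0').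
by rewrite !mxE eqxx => /eqP; rewrite oner_eq0.
Qed.

End UniqueSplitting.

(** A subspace of largest dimension inside [Q] absorbs every vector of [Q], since adjoining one
    stays inside [Q]. *)
Lemma vspace_of_pred (K : fieldType) (V : vectType K) (Q : V -> Prop) :
  Q 0 -> (forall a u v, Q u -> Q v -> Q (a *: u + v)) ->
  exists U : {vspace V}, forall v, v \in U <-> Q v.
Proof.
move=> Q0 Qlin.
pose dimQ n := `[< exists U : {vspace V}, \dim U = n /\ forall v, v \in U -> Q v >].
have exQ : exists n, dimQ n.
  exists 0%N; apply/asboolP; exists 0%VS; rewrite dimv0; split=> // v.
  by rewrite memv0 => /eqP ->.
have bQ n : dimQ n -> (n <= \dim {:V})%N.
  by move=> /asboolP[U [<- _]]; apply/dimvS/subvf.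
case: (ex_maxnP exQ bQ) => n /asboolP[U [dU UQ]] nmax.
exists U => v; split=> [|Qv]; first exact: UQ.
have UvQ : dimQ (\dim (U + <[v]>)).
  apply/asboolP; exists (U + <[v]>)%VS; split=> // _ /memv_addP[u uU [_ /vlineP[a ->] ->]].
  by rewrite addrC; apply: Qlin => //; exact: UQ.
have UE : (U == U + <[v]>)%VS by rewrite eqEdim addvSl dU nmax.
by rewrite (eqP UE); apply: (subvP (addvSr _ _)); exact: memv_line.
Qed.

Section LinearCombinations.
Variable K : fieldType.
Local Notation S := {mpoly K[3]}.

Definition lcomb n (c : 'rV[K]_n) (x : 'I_n -> 'rV[S]_3) : 'rV[S]_3 :=
  \sum_i (c 0 i)%:MP *: x i.

Lemma lcomb_mulmx m n (v : 'rV[K]_m) (A : 'M[K]_(m, n)) x :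
  lcomb (v *m A) x = \sum_i (v 0 i)%:MP *: lcomb (row i A) x.
Proof.
under [RHS]eq_bigr => i _ do rewrite scaler_sumr.
rewrite exchange_big; apply: eq_bigr => j _ /=; rewrite mxE rmorph_sum scaler_suml.
by apply: eq_bigr => i _; rewrite mxE scalerA rmorphM.
Qed.

Lemma AR_lcomb f k n (c : 'rV[K]_n) x : (forall i, AR f k (x i)) -> AR f k (lcomb c x).
Proof.
move=> hx; apply: (big_ind (AR f k)) => [|u v|i _]; [exact: AR0|exact: AR_add|].
rewrite -[k]add0r; apply: AR_scale => //=.
by rewrite -[_%:MP]mulr1 mul_mpolyC dhomogZ ?dhomog1.
Qed.

Lemma AR_basis f (k : nat) : exists D (w : 'I_D -> 'rV[S]_3),
  [/\ forall i, AR f k (w i), forall m, AR f k m -> exists z, m = lcomb z w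
    & forall z, lcomb z w = 0 -> z = 0].
Proof.
pose V := {ffun 'I_3 -> dhomog 3 K k}.
pose row_of (v : V) : 'rV[S]_3 := \row_i val (v i).
have row_ofP a (u v : V) : row_of (a *: u + v) = a%:MP *: row_of u + row_of v.
  by apply/rowP => i; rewrite !mxE !ffunE /= mul_mpolyC.
have row_of_inj (v : V) : row_of v = 0 -> v = 0.
  by move=> v0; apply/ffunP => i; apply/val_inj; move/rowP/(_ i): v0; rewrite !mxE !ffunE.
have row_of0 : row_of 0 = 0 by apply/rowP => i; rewrite !mxE ffunE.
have [||U UE] := @vspace_of_pred K V (fun v => syzygy f (row_of v)).
- by rewrite row_of0; case: (AR0 f 0).
- by move=> a u v su sv; rewrite row_ofP; exact: syzygy_linear.
pose w i := row_of (vbasis U)`_i.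
have lcombE z : lcomb z (fun i : 'I_(\dim U) => w i) = row_of (\sum_i z 0 i *: (vbasis U)`_i).
  rewrite /lcomb; elim/big_ind2: _ => [|u u' v v' -> ->|i _]; first by rewrite row_of0.
    by have := row_ofP 1 u v; rewrite scale1r mpolyC1 scale1r => ->.
  by have := row_ofP (z 0 i) (vbasis U)`_i 0; rewrite addr0 row_of0 addr0 => ->.
exists (\dim U), (fun i => w i); split.
- move=> i; split; first by move=> j; rewrite mxE; exact: dhomog_is_dhomog.
  by apply/UE; apply: vbasis_mem; rewrite mem_nth // size_tuple.
- move=> m [hm sm]; pose v : V := [ffun i => DHomog (hm i : _ \is k.-homog)].
  have mE : m = row_of v by apply/rowP => i; rewrite mxE ffunE.
  have vU : v \in U by apply/UE; rewrite -mE.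
  exists (\row_i coord (vbasis U) i v); rewrite lcombE mE {1}(coord_vbasis vU).
  by congr row_of; apply: eq_bigr => i _; rewrite mxE.
- move=> z; rewrite lcombE => /row_of_inj z0; apply/rowP => i; rewrite mxE.
  by have /freeP := basis_free (vbasisP U); apply.
Qed.

End LinearCombinations.

(** * Comparing the sums of degrees on two lines by a dimension count *)

Section SumOfDegrees.
Variables (K : fieldType) (f : {mpoly K[3]}) (M M' : 'M[K]_3).
Hypotheses (Mu : M \in unitmx) (Mu' : M' \in unitmx).
Local Notation S := {mpoly K[3]}.
Local Notation "p ^R" := (map_mx (restr M) p) (at level 2, format "p ^R").
Local Notation "p ^R'" := (map_mx (restr M') p) (at level 2, format "p ^R'").
Variables (sigma1 sigma2 : 'rV[{poly K}]_3) (d1 d2 e1 e2 : int) (k0 : nat).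
Hypothesis sigma_free : forall a b, a *: sigma1 + b *: sigma2 = 0 -> a = 0 /\ b = 0.
Hypothesis AR_lift : forall (k : nat) a b, (k0 <= k)%N ->
  degz (k%:Z - d1) a -> degz (k%:Z - d2) b ->
  exists2 m, AR f k%:Z m & m^R = a *: sigma1 + b *: sigma2.
Hypothesis isoM' :
  isomorphic_on_line (AR f) (twist2 e1 e2 : gpieces 'rV[S]_2) (lform M' 0).

(** On M, dim AR(f)_k - dim AR(f)_(k-1) >= 2(k+1) - d1 - d2 for k large, while
    on M' it is at most 2(k+1) - e1 - e2. *)
Lemma twist2_sum_le : e1 + e2 <= d1 + d2.
Proof.
have [//|de] := leP (e1 + e2) (d1 + d2).
have [psi psiS] := isoM'.
have Asat' := AR_saturated Mu' f; have Esat := twist2_saturated Mu' e1 e2.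
(* Large enough for the numbers of monomials [a], [b], [a'], [b'] to be nonnegative and for lifting
   in degree [k]. *)
pose n := (k0 + `|d1| + `|d2| + `|e1| + `|e2|)%N; pose k := n.+1.
have [a aE] : exists a : nat, a%:Z = k%:Z - d1 + 1 by exists (absz (k%:Z - d1 + 1)); lia.
have [b bE] : exists b : nat, b%:Z = k%:Z - d2 + 1 by exists (absz (k%:Z - d2 + 1)); lia.
have [a' aE'] : exists a : nat, a%:Z = k%:Z - e1 + 1 by exists (absz (k%:Z - e1 + 1)); lia.
have [b' bE'] : exists b : nat, b%:Z = k%:Z - e2 + 1 by exists (absz (k%:Z - e2 + 1)); lia.
have ab : (a' + b' < a + b)%N by lia.
have kk0 : (k0 <= k)%N by lia.
have [D [w [hw wspan wfree]]] := AR_basis f n.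
have degXn (j : nat) (t : int) : j%:Z <= t -> degz t ('X^j : {poly K}).
  by move=> jt i ti; rewrite coefXn; case: eqP => // ij; lia.
have /fin_all_exists[xa xaP] (j : 'I_a) : exists m, AR f k m /\ m^R = 'X^j *: sigma1.
  have [||m hm mE] := @AR_lift k 'X^j 0 kk0; [|exact: degz0|].
    by apply: degXn; have := ltn_ord j; lia.
  by exists m; rewrite mE scale0r addr0.
have /fin_all_exists[xb xbP] (j : 'I_b) : exists m, AR f k m /\ m^R = 'X^j *: sigma2.
  have [||m hm mE] := @AR_lift k 0 'X^j kk0; [exact: degz0| |].
    by apply: degXn; have := ltn_ord j; lia.
  by exists m; rewrite mE scale0r add0r.
(* An independent family in [AR(f)_k]: [lform M 0] times a basis of [AR(f)_(k-1)], then lifts of the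
   ['X^j *: sigma1] and ['X^j *: sigma2]. *)
pose x (t : 'I_(D + (a + b))) := match split t with
  | inl i => lform M 0 *: w i
  | inr t' => match split t' with inl j => xa j | inr j => xb j end end.
have lcombx c : lcomb c x = lform M 0 *: lcomb (lsubmx c) w
    + (lcomb (lsubmx (rsubmx c)) xa + lcomb (rsubmx (rsubmx c)) xb).
  rewrite /lcomb big_split_ord big_split_ord /=; congr (_ + (_ + _)).
  - rewrite scaler_sumr; apply: eq_bigr => i _.
    by rewrite /x (unsplitK (inl i)) !mxE !scalerA mulrC.
  - by apply: eq_bigr => j _; rewrite /x (unsplitK (inr _)) (unsplitK (inl j)) !mxE.
  - by apply: eq_bigr => j _; rewrite /x (unsplitK (inr _)) (unsplitK (inr j)) !mxE.
have hx t : AR f k (x t).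
  rewrite /x; case: split => [i|t'].
    rewrite (_ : k%:Z = 1%:Z + n%:Z) ?PoszD; last by lia.
    by apply: AR_scale (hw i); exact: lform_homog.
  by case: split => j; [case: (xaP j) | case: (xbP j)].
have lcombR m (c : 'rV[K]_m) (y : 'I_m -> 'rV[S]_3) sg : (forall j, (y j)^R = 'X^j *: sg) ->
    (lcomb c y)^R = (\poly_(j < m) (oapp (c 0) 0 (insub j))) *: sg.
  move=> yE; rewrite raddf_sum poly_def scaler_suml; apply: eq_bigr => j _.
  by rewrite /= map_mxZ yE scalerA /= restrC mul_polyC valK.
have poly_c0 m (c : 'rV[K]_m) : \poly_(j < m) (oapp (c 0) 0 (insub j)) = 0 -> c = 0.
  move=> /polyP c0; apply/rowP => j; have := c0 j.
  by rewrite coef_poly ltn_ord coef0 valK mxE.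
have xfree c : lcomb c x = 0 -> c = 0.
  rewrite lcombx => c0; have := congr1 (map_mx (restr M)) c0.
  rewrite !map_mxD map_mxZ restr_lform0 // scale0r add0r map_mx0.
  rewrite (lcombR _ _ _ sigma1) => [|j]; last by case: (xaP j).
  rewrite (lcombR _ _ _ sigma2) => [|j]; last by case: (xbP j).
  case/sigma_free => /poly_c0 ca /poly_c0 cb.
  have lcomb0 m (y : 'I_m -> 'rV[S]_3) : lcomb 0 y = 0.
    by rewrite /lcomb big1 // => j _; rewrite mxE mpolyC0 scale0r.
  move: c0; rewrite ca cb !lcomb0 !addr0 => /eqP.
  rewrite scalemx_eq0 (negPf (lform_neq0 Mu 0)) => /eqP/wfree cw.
  by rewrite -[c]hsubmxK -[rsubmx c]hsubmxK ca cb cw !row_mx0.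
have /fin_all_exists[y yP] t : exists y : 'rV[{poly K}]_2,
    [/\ glob_rel M' (AR f) psi (x t)^R' y, degz (k%:Z - e1) (y 0 0)
      & degz (k%:Z - e2) (y 0 1)].
  have [y hy xy] := glob_push Mu' Asat' Esat psiS (glob_AR M' (hx t)).
  by exists y; have [y0 y1] := glob_twist2 Mu' hy; rewrite subr0 in y0 y1.
(* The images of the family on the line of [M'], by their coefficients; the degree bounds leave
   [a' + b'] of them. *)
pose Y : 'M[K]_(D + (a + b), a' + b') := \matrix_(t, j) match split j with
  | inl j => (y t 0 0)`_j | inr j => (y t 0 1)`_j end.
have kerY (c : 'rV[K]_(D + (a + b))) : c *m Y = 0 ->
    exists z, lcomb c x = lform M' 0 *: lcomb z w.
  move=> cY; have rel : glob_rel M' (AR f) psi (lcomb c x)^R' (\sum_t (c 0 t)%:P *: y t).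
    rewrite raddf_sum; elim/big_ind2: _ => [|u u' v v'|t _].
    - exact: (glob_rel0 Mu' Asat' Esat psiS (AR0 f 0)).
    - exact: (glob_relD Mu' Asat' Esat psiS).
    - rewrite /= map_mxZ /= restrC; apply: (glob_relZ Mu' Asat' Esat psiS).
      by case: (yP t).
  have y0 : \sum_t (c 0 t)%:P *: y t = 0.
    have coefE (i : 'I_2) (j : nat) :
        ((\sum_t (c 0 t)%:P *: y t) 0 i)`_j = \sum_t c 0 t * (y t 0 i)`_j.
      by rewrite summxE coef_sum; apply: eq_bigr => t _; rewrite mxE coefCM.
    apply/rowP => i; rewrite [RHS]mxE; apply/polyP => j; rewrite coef0 coefE.
    have : (i == 0) || (i == 1) by case: i => -[|[]].
    case/orP => /eqP ->.
    - have [ja|aj] := ltnP j a'; last first.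
        by rewrite big1 // => t _; case: (yP t) => _ h _; rewrite h ?mulr0 //; lia.
      move/rowP/(_ (lshift b' (Ordinal ja))): cY; rewrite !mxE => cY.
      rewrite -[RHS]cY; apply: eq_bigr => t _.
      by rewrite mxE (unsplitK (inl (Ordinal ja))).
    - have [ja|aj] := ltnP j b'; last first.
        by rewrite big1 // => t _; case: (yP t) => _ _ h; rewrite h ?mulr0 //; lia.
      move/rowP/(_ (rshift a' (Ordinal ja))): cY; rewrite !mxE => cY.
      rewrite -[RHS]cY; apply: eq_bigr => t _.
      by rewrite mxE (unsplitK (inr (Ordinal ja))).
  have /(glob_rel_inj Mu' Asat' Esat psiS rel) cx := glob_rel0 Mu' Asat' Esat psiS (AR0 f 0).
  have [w' hw' ->] := sat_div Asat' (AR_lcomb c hx) (cx.2 y0).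
  have [|z ->] := wspan w'; last by exists z.
  by rewrite (_ : n%:Z = k%:Z - 1) //; lia.
have kY i : row i (kermx Y) *m Y = 0 by rewrite -row_mul mulmx_ker row0.
have /fin_all_exists[z zP] i := kerY _ (kY i).
pose Z := \matrix_i z i.
have kerZ : (kermx Z <= kermx (kermx Y))%MS.
  apply/sub_kermxP/row_matrixP => i; rewrite row_mul row0; apply: xfree.
  rewrite lcomb_mulmx.
  under eq_bigr => j _ do rewrite zP scalerA mulrC -scalerA -[z j](rowK z).
  rewrite -scaler_sumr -/Z -lcomb_mulmx -row_mul mulmx_ker row0.
  by rewrite /lcomb big1 ?scaler0 // => j _; rewrite mxE mpolyC0 scale0r.
(* By [kerZ] the kernel of [Y] has dimension at most [D], and the rank of [Y] is at most [a' + b'];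
   so [a + b <= a' + b'], against [ab]. *)
have := mxrankS kerZ; rewrite !mxrank_ker.
have := rank_leq_col Y; have := rank_leq_col Z; have := rank_leq_row Y; lia.
Qed.

End SumOfDegrees.

Lemma twist2_first_le_mdr (K : fieldType) (f : {mpoly K[3]}) r rho1 (M : 'M[K]_3)
    (e1 e2 : int) :
  is_mdr f r -> AR f r%:Z rho1 -> rho1 != 0 -> M \in unitmx ->
  isomorphic_on_line (AR f) (twist2 e1 e2 : gpieces 'rV[{mpoly K[3]}]_2) (lform M 0) ->
  e1 <= e2 -> e1 <= r%:Z.
Proof.
move=> hr hrho1 rho1_neq0 Mu [psi psiS] e12; have [//|re] := leP e1 r%:Z.
have Asat := AR_saturated Mu f; have Esat := twist2_saturated Mu e1 e2.
have [y hy xy] := glob_push Mu Asat Esat psiS (glob_AR M hrho1).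
have [y0 y1] := glob_twist2 Mu hy; rewrite subr0 in y0 y1.
have yE : y = 0.
  apply/rowP => i; rewrite mxE; have : (i == 0) || (i == 1) by case: i => -[|[]].
  by case/orP => /eqP ->; [apply: degz_lt0 y0 | apply: degz_lt0 y1];
    rewrite subr_lt0 // (lt_le_trans re).
have /(glob_rel_inj Mu Asat Esat psiS xy)[_ /(_ yE)] := glob_rel0 Mu Asat Esat psiS (AR0 f 0).
by move/eqP; rewrite (negPf (restr_syzygy_neq0 hr hrho1 rho1_neq0 Mu)).
Qed.

Theorem theorem5p4 (R : realType) (d r : nat) (f : {mpoly R[i][3]})
    (rho1 : 'rV[{mpoly R[i][3]}]_3)
    (hf : reduced_curve d f)
    (hr : is_mdr f r) (hr1 : (1 <= r)%N)
    (hrho1 : AR f r%:Z rho1) (hrho1_neq0 : rho1 <> 0)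
    (h2r : (2 * r <= d)%N)
    (a : 'rV[R[i]]_3) (ha : a != 0)
    (havoid : forall p : 'rV[R[i]]_3, on_line a p -> ~ suppZ f rho1 p) :
  ~ jumping_line f a /\ splitting_type f a r%:Z (d%:Z - 1 - r%:Z).
Proof.
have rho1_neq0 : rho1 != 0 by apply/eqP.
have [M Mu Ma] := row0_unitmx ha.
(* The subtraction is not truncated: [1 <= r] and [2 r <= d] give [r + 1 <= d]. *)
pose s := (d - r.+1)%N.
have dE : d = (r + s).+1 by rewrite /s; lia.
have sE : d%:Z - 1 - r%:Z = s%:Z by lia.
have rs : (r <= s.+1)%N by lia.
rewrite -Ma in havoid *; rewrite dE in hf.
have split := splitting_on_line hf hr hrho1 rho1_neq0 Mu havoid rs.
rewrite sE; split=> //; case=> e1 [e2 [d1 [d2 [[P [P0 _ Pgen]] [d12 d_type]]]]].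
(* The factor ['X_0] makes the chosen point nonzero, so that it defines a line. *)
rewrite subr_gt0 => de; have [v Pv] : exists v : 'I_3 -> R[i], (P * 'X_0).@[v] != 0.
  by apply: exists_nonzero_meval; rewrite mulf_neq0 // -msize_poly_eq0 msizeX.
pose a' := \row_i v i; have a'E q : q.@[fun i => a' 0 i] = q.@[v].
  by apply: meval_eq => i; rewrite mxE.
move: Pv; rewrite mevalM mulf_eq0 negb_or mevalXU => /andP[Pv v0].
have a'0 : a' != 0 by apply: contraNneq v0 => /rowP/(_ 0); rewrite !mxE => ->.
have [|e12 e_type] := Pgen a' a'0; first by rewrite a'E.
have [M' Mu' Ma'] := row0_unitmx a'0; rewrite -Ma' in e_type.
have er := twist2_first_le_mdr hr hrho1 rho1_neq0 Mu' e_type e12.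
have [sigma2 [k0 [_ free lift]]] := splitting_basis hf hr hrho1 rho1_neq0 Mu havoid rs.
have ers := twist2_sum_le Mu Mu' free lift e_type.
(* By integrality, [2 e1 <= e1 + e2 <= r + s <= 2 s + 1] gives [e1 <= s]; with [e1 <= r] and
   [d1 < e1], [d1] is below both [r] and [s]. *)
by apply: (twist2_first_le Mu split d_type); lia.
Qed.
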